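(* Fix $W,N,k\in\mathbb{N}_+$ and $K>0$, and let $(P,\preccurlyeq,d)$ be a $k$-point causal metric space with doubling constant $K$ and width $W$, whose points are feature vectors, $P=\{x_v\}_{v\in V}\subseteq\mathbb{R}^N$. Then there exist $D\in\mathcal{O}(\log(K))$, $T:=W$, a multilayer perceptron $\mathcal{E}:\mathbb{R}^N\to\mathbb{R}^{D+T}$, a map $\mathcal{T}:\mathbb{R}^{D+T}\to\mathbb{R}^T$ admitting a neural partial order representation, and a map $\mathcal{D}:\mathbb{R}^{D+T}\times\mathbb{R}^{D+T}\to[0,\infty)$ admitting a neural (quasi-)metric representation, such that for all $x_u,x_v\in P$: (i) (Order embedding) $x_u\preccurlyeq x_v$ if and only if $\mathcal{E}(x_u)\lesssim^{\mathcal{T}}\mathcal{E}(x_v)$; (ii) (Metric embedding) $d(x_u,x_v)\le\mathcal{D}(\mathcal{E}(x_u),\mathcal{E}(x_v))\le\mathcal{O}(\log(K)^5)\,d(x_u,x_v)$, where the implied constant is absolute. Furthermore, there is some $D\le k$ for which (ii) can be improved to $d(x_u,x_v)=\mathcal{D}(\mathcal{E}(x_u),\mathcal{E}(x_v))$ for all $x_u,x_v\in P$ (while (i) still holds). In either case: together, $\mathcal{D}$ and $\mathcal{T}$ are defined by a total of $D+T+8$ non-zero parameters; $\mathcal{E}$ depends on $\mathcal{O}\big(k^{5/2}D^4N\log(N)\log\big(k^2\operatorname{diam}(P,d)/\operatorname{sep}(P,d)\big)\big)$ non-zero parameters; consequently $\mathcal{D},\mathcal{T},\mathcal{E}$ together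 depend on at most $\mathcal{O}\big(D+T+k^{5/2}D^4N\log(N)\log\big(k^2\operatorname{diam}(P,d)/\operatorname{sep}(P,d)\big)\big)$ non-zero parameters.
   Context: A causal metric space is a triple $(P,d,\preccurlyeq)$ where $(P,d)$ is a metric space and $(P,\preccurlyeq)$ is a partially ordered set. An anti-chain is a subset $S\subseteq P$ such that no two distinct elements of $S$ are comparable; the width of the poset is the maximal cardinality of an anti-chain. The doubling constant of a metric space $(X,d)$ is the smallest integer $K\ge1$ such that every open ball $B(x,r)$ can be covered by at most $K$ open balls of radius $r/2$. $\operatorname{diam}(P,d)=\sup_{x,y\in P}d(x,y)$ and $\operatorname{sep}(P,d)=\inf_{x\ne y}d(x,y)$ (set to $1$ if $P$ is a singleton). For $s,l>0$ define $\sigma_{s,l}:\mathbb{R}\to\mathbb{R}$ by $\sigma_{s,l}(x)=\operatorname{sgn}(x)|x|^s$ if $|x|<1$ and $\operatorname{sgn}(x)|x|^l$ if $|x|\ge1$, where $\operatorname{sgn}(x)=1$ for $x\ge0$ and $-1$ for $x<0$; $\sigma\bullet$ denotes componentwise application. For $m\in\mathbb{N}_+$, $I^+_m$ denotes the set of $m\times m$ matrices of the form $\lambda I_m+|\tilde{W}|$ with $\lambda>0$, $\tilde W$ an arbitrary real $m\times m$ matrix and $|\cdot|$ the entrywise absolute value. For $x\in\mathbb{R}^{D+T}$, $x_{1:D}$ denotes its first $D$ coordinates and $x_{D+1:D+T}$ its last $T$ coordinates. A map $\mathcal{D}:\mathbb{R}^{D+T}\times\mathbb{R}^{D+T}\to[0,\infty)$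 has a neural (quasi-)metric representation if there are $J\in\mathbb{N}_+$, $s_0,l_0,\dots,s_J,l_J>0$, matrices $\mathsf{W}_j\in I^+_D$ for $j<J$ and $\mathsf{W}_J\in(0,\infty)^{1\times D}$ such that $\mathcal{D}(x,y)=\mathsf{W}_J\sigma_{s_J,l_J}\bullet(u_{J-1})$, $u_j=\mathsf{W}_j\sigma_{s_j,l_j}\bullet(u_{j-1})$ for $j=1,\dots,J-1$, and $u_0=|\sigma_{s_0,l_0}\bullet(x_{1:D})-\sigma_{s_0,l_0}\bullet(y_{1:D})|$ (absolute value componentwise). A map $\mathcal{T}:\mathbb{R}^{D+T}\to\mathbb{R}^T$ has a neural partial order representation if there are $\tilde J\in\mathbb{N}_+$, $\tilde s_1,\dots,\tilde s_{\tilde J}>0$, $\mathsf{V}_j\in I^+_T$ and $b_j\in\mathbb{R}^T$ with $\mathcal{T}(x)=z_{\tilde J}$, $z_j=\mathsf{V}_j\,\sigma_{\tilde s_j,\tilde s_j}\bullet(\mathrm{LR}\bullet(z_{j-1}))+b_j$ for $j=1,\dots,\tilde J$, and $z_0=x_{D+1:D+T}$, where $\mathrm{LR}$ is the LeakyReLU function ($x\mapsto x$ for $x\ge0$, $x\mapsto ax$ for $x<0$, fixed $a\in(0,1)$). The induced relation is $x\lesssim^{\mathcal{T}}y$ iff $\mathcal{T}(x)_t\le\mathcal{T}(y)_t$ for every coordinate $t=1,\dots,T$.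
   Formalization: Every log in the bounds is read as 1+log(max(1,·)), since for N=1 or a one-point space the stated bounds vanish or are undefined; ''a total of D+T+8 non-zero parameters'' is read as at most D+T+8, and the perceptron uses ReLU. *)

(* Defs.v *)
From HB Require Import structures.
From mathcomp Require Import all_boot all_order all_algebra.
From mathcomp Require Import reals exp.
Set Implicit Arguments. Unset Strict Implicit. Unset Printing Implicit Defensive.
Import Order.TTheory GRing.Theory Num.Theory.
Local Open Scope ring_scope.

Section Defs.
Variable R : realType.

Definition is_metric (k : nat) (d : 'I_k -> 'I_k -> R) : Prop :=
  [/\ forall i j, 0 <= d i j,
      forall i j, d i j = 0 <-> i = j,
      forall i j, d i j = d j i &
      forall i j l, d i l <= d i j + d j l].

Definition is_partial_order (k : nat) (le : 'I_k -> 'I_k -> Prop) : Prop :=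
  [/\ forall i, le i i,
      forall i j, le i j -> le j i -> i = j &
      forall i j l, le i j -> le j l -> le i l].

Definition is_antichain (k : nat) (le : 'I_k -> 'I_k -> Prop) (S : {set 'I_k}) : Prop :=
  forall i j, i \in S -> j \in S -> i != j -> ~ le i j /\ ~ le j i.

Definition width (k : nat) (le : 'I_k -> 'I_k -> Prop) (W : nat) : Prop :=
  (exists S : {set 'I_k}, is_antichain le S /\ #|S| = W) /\
  (forall S : {set 'I_k}, is_antichain le S -> (#|S| <= W)%N).

Definition doubling_ok (k : nat) (d : 'I_k -> 'I_k -> R) (K : nat) : Prop :=
  forall (i : 'I_k) (r : R), 0 < r ->
    exists C : {set 'I_k}, (#|C| <= K)%N /\
      forall j, d i j < r -> exists2 c, c \in C & d c j < r / 2.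

Definition doubling_constant (k : nat) (d : 'I_k -> 'I_k -> R) (K : nat) : Prop :=
  [/\ (1 <= K)%N, doubling_ok d K &
      forall K', (1 <= K')%N -> doubling_ok d K' -> (K <= K')%N].

Definition diam (k : nat) (d : 'I_k -> 'I_k -> R) : R :=
  \big[Num.max/0]_(i : 'I_k) \big[Num.max/0]_(j : 'I_k) d i j.

Definition sep (k : nat) (d : 'I_k -> 'I_k -> R) : R :=
  if (k <= 1)%N then 1
  else \big[Num.min/diam d]_(i : 'I_k) \big[Num.min/diam d]_(j : 'I_k | j != i) d i j.

Definition sgn (x : R) : R := if 0 <= x then 1 else -1.

Definition sigma (s l x : R) : R :=
  if `|x| < 1 then sgn x * (`|x| `^ s) else sgn x * (`|x| `^ l).

Definition leaky_relu (a x : R) : R := if 0 <= x then x else a * x.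

Definition relu (x : R) : R := Num.max x 0.

Definition in_Iplus (m : nat) (M : 'M[R]_m) : Prop :=
  exists lam : R, 0 < lam /\
    exists Wt : 'M[R]_m, M = lam%:M + map_mx (fun z => `|z|) Wt.

Definition nnz (m n : nat) (A : 'M[R]_(m, n)) : nat :=
  \sum_(i < m) \sum_(j < n) (A i j != 0%R : nat).

(* layers j = 1..J-1 use nm_W j : 'M_D ; the last layer uses nm_WJ ;
   exponents s_j, l_j for j = 0..J *)
Record nmetric (D : nat) := NMetric {
  nm_J : nat;
  nm_s : nat -> R;
  nm_l : nat -> R;
  nm_W : nat -> 'M[R]_D;
  nm_WJ : 'rV[R]_D }.

Definition nmetric_valid (D : nat) (m : nmetric D) : Prop :=
  [/\ (0 < nm_J m)%N,
      forall j, (j <= nm_J m)%N -> 0 < nm_s m j /\ 0 < nm_l m j,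
      forall j, (1 <= j)%N -> (j < nm_J m)%N -> in_Iplus (nm_W m j) &
      forall i, 0 < nm_WJ m 0 i].

Fixpoint nm_u (D T : nat) (m : nmetric D) (x y : 'cV[R]_(D + T)) (j : nat)
  : 'cV[R]_D :=
  match j with
  | 0 => map_mx (fun z => `|z|)
           (map_mx (sigma (nm_s m 0) (nm_l m 0)) (usubmx x)
            - map_mx (sigma (nm_s m 0) (nm_l m 0)) (usubmx y))
  | j'.+1 => nm_W m j'.+1 *m
               map_mx (sigma (nm_s m j'.+1) (nm_l m j'.+1)) (nm_u m x y j')
  end.

Definition nmetric_eval (D T : nat) (m : nmetric D) (x y : 'cV[R]_(D + T)) : R :=
  (nm_WJ m *m map_mx (sigma (nm_s m (nm_J m)) (nm_l m (nm_J m)))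
                     (nm_u m x y (nm_J m).-1)) 0 0.

(* parameters: non-zero weights of all layers + the 2(J+1) exponents *)
Definition nmetric_count (D : nat) (m : nmetric D) : nat :=
  (\sum_(1 <= j < nm_J m) nnz (nm_W m j) + nnz (nm_WJ m) + 2 * (nm_J m).+1)%N.

Record norder (T : nat) := NOrder {
  no_J : nat;
  no_s : nat -> R;
  no_V : nat -> 'M[R]_T;
  no_b : nat -> 'cV[R]_T }.

Definition norder_valid (T : nat) (o : norder T) : Prop :=
  [/\ (0 < no_J o)%N,
      forall j, (1 <= j)%N -> (j <= no_J o)%N -> 0 < no_s o j &
      forall j, (1 <= j)%N -> (j <= no_J o)%N -> in_Iplus (no_V o j)].

Fixpoint no_z (a : R) (D T : nat) (o : norder T) (x : 'cV[R]_(D + T)) (j : nat)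
  : 'cV[R]_T :=
  match j with
  | 0 => dsubmx x
  | j'.+1 => no_V o j'.+1 *m
               map_mx (sigma (no_s o j'.+1) (no_s o j'.+1))
                 (map_mx (leaky_relu a) (no_z a o x j')) + no_b o j'.+1
  end.

Definition norder_eval (a : R) (D T : nat) (o : norder T) (x : 'cV[R]_(D + T))
  : 'cV[R]_T := no_z a o x (no_J o).

(* parameters: non-zero weights and biases + the J~ exponents *)
Definition norder_count (T : nat) (o : norder T) : nat :=
  (\sum_(1 <= j < (no_J o).+1) (nnz (no_V o j) + nnz (no_b o j)) + no_J o)%N.

Definition order_leT (T : nat) (u v : 'cV[R]_T) : Prop :=
  forall t : 'I_T, u t 0 <= v t 0.

End Defs.

Inductive mlp (R : realType) : nat -> nat -> Type :=
| MLPout (n m : nat) of 'M[R]_(m, n) & 'cV[R]_m : mlp R n m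
| MLPhid (n h m : nat) of 'M[R]_(h, n) & 'cV[R]_h & mlp R h m : mlp R n m.

Fixpoint mlp_eval (R : realType) (n m : nat) (f : mlp R n m) : 'cV[R]_n -> 'cV[R]_m :=
  match f in mlp _ n m return 'cV[R]_n -> 'cV[R]_m with
  | MLPout _ _ A b => fun x => A *m x + b
  | MLPhid _ _ _ A b g => fun x => mlp_eval g (map_mx (@relu R) (A *m x + b))
  end.

Fixpoint mlp_count (R : realType) (n m : nat) (f : mlp R n m) : nat :=
  match f with
  | MLPout _ _ A b => (nnz A + nnz b)%N
  | MLPhid _ _ _ A b g => (nnz A + nnz b + mlp_count g)%N
  end.

(* log with the usual convention for O-bounds: 1 + ln(max(1,x)) >= 1 *)
Definition lg (R : realType) (x : R) : R := 1 + ln (Num.max 1 x).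

Definition enc_bound (R : realType) (k D N : nat) (dm sp : R) : R :=
  (k%:R `^ (5%:R / 2%:R)) * (D%:R ^+ 4) * N%:R * lg N%:R
  * lg ((k ^ 2)%:R * dm / sp).

(* Main.v *)
Require Import Defs.
From HB Require Import structures.
From mathcomp Require Import boolp classical_sets.
From mathcomp Require Import all_boot all_order all_algebra.
From mathcomp Require Import reals exp.
From mathcomp Require Import ring lra zify.
Set Implicit Arguments. Unset Strict Implicit. Unset Printing Implicit Defensive.
Import Order.TTheory GRing.Theory Num.Theory.
Local Open Scope ring_scope.

(** The approximate metric part is a snowflake embedding of a doubling space
    with optimal dimension. Scales decrease by the factor [mu ^+ 4], where [mu]
    is of order the square root of [log K]. At a scale [r], every coordinate
    gets a 1-Lipschitz function [x |-> max_z (h z - d x z)] over an [r]-net,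
    with heights [h z] drawn from a truncated geometric law. The law is nearly
    memoryless, so the value at [x] is anti-concentrated given the values far
    from [x]: a single coordinate fails to separate a given pair with
    probability [(log K)^(-1/2)], up to a constant. All [O(log K)] coordinates
    fail with probability [K^(- c log log K)], which beats the number of
    neighbouring pairs in a net of granularity [r / polylog K], and the
    Lovasz local lemma produces heights that separate all pairs, whatever the
    contribution of the coarser scales. The finer scales are too small to undo
    this. Summing the scales with weights [r^(-1/4)] gives coordinates whose
    differences, raised to the power [4/3] and summed, are comparable to [d].

    The exact part uses [k] coordinates and a huge exponent [p]: coordinate [i]
    vanishes at the point [i] and is the [p]-th root of roughly half of [d i j]
    at the point [j]; the contributions to pairs not containing [i] are tiny,
    and a contraction argument makes the sum exactly [d].

    The order part embeds the poset by counting the elements below a point in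
    each chain of a Dilworth decomposition, and the perceptron interpolates the
    resulting vectors after a projection to a line separating the points. *)

(** * Product probability and the local lemma *)

Section ProductProbability.
Variables (R : realFieldType) (J U : finType) (w : U -> R).
Hypotheses (w_ge0 : forall u, 0 <= w u) (w_sum1 : \sum_u w u = 1).
Implicit Types (A B : pred {ffun J -> U}) (o : {ffun J -> U}) (S : {set J}).

Definition prodw o : R := \prod_j w (o j).
Definition Pr A : R := \sum_(o | A o) prodw o.

Definition depends_on S A :=
  forall o o', (forall j, j \in S -> o j = o' j) -> A o = A o'.

Definition mix S o o' : {ffun J -> U} :=
  [ffun j => if j \in S then o j else o' j].

Lemma prodw_ge0 o : 0 <= prodw o.
Proof. exact: prodr_ge0. Qed.

Lemma Pr_ge0 A : 0 <= Pr A.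
Proof. by apply: sumr_ge0 => o _; exact: prodw_ge0. Qed.

Lemma Pr_box (V : J -> pred U) :
  Pr (fun o => [forall j, V j (o j)]) = \prod_j \sum_(u | V j u) w u.
Proof. by rewrite bigA_distr_big_dep; apply: eq_bigl => o. Qed.

Lemma PrT : Pr xpredT = 1.
Proof.
have -> : 1 = \prod_(j : J) \sum_u w u by rewrite big1.
by rewrite (bigA_distr_bigA (fun _ u => w u)).
Qed.

Lemma eq_Pr A B : A =1 B -> Pr A = Pr B.
Proof. by move=> AB; apply: eq_bigl. Qed.

Lemma PrE A : Pr A = \sum_o prodw o * (A o)%:R.
Proof.
by rewrite /Pr big_mkcond /=; apply: eq_bigr => o _; case: (A o); rewrite ?mulr1 ?mulr0.
Qed.

Lemma le_Pr A B : (forall o, A o -> B o) -> Pr A <= Pr B.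
Proof.
move=> AB; rewrite !PrE; apply: ler_sum => o _.
rewrite ler_wpM2l ?prodw_ge0 // ler_nat.
by case: (A o) (AB o) => // ->.
Qed.

Lemma Pr_le1 A : Pr A <= 1.
Proof. by rewrite -PrT; exact: le_Pr. Qed.

Lemma PrD A B : (forall o, B o -> A o) ->
  Pr (fun o => A o && ~~ B o) = Pr A - Pr B.
Proof.
move=> BA; rewrite !PrE -sumrB; apply: eq_bigr => o _.
rewrite -mulrBr; congr (_ * _).
by case: (B o) (BA o); case: (A o) => //= H; rewrite ?subr0 ?subrr //; move: (H isT).
Qed.

Lemma le_PrU (E : finType) (P : pred E) A (B : E -> pred {ffun J -> U}) :
  (forall o, A o -> exists2 e, P e & B e o) ->
  Pr A <= \sum_(e | P e) Pr (B e).
Proof.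
move=> AB; under eq_bigr do rewrite PrE.
rewrite PrE exchange_big; apply: ler_sum => o _.
rewrite -mulr_sumr ler_wpM2l ?prodw_ge0 //.
have [Ao|_] := boolP (A o); last by apply: sumr_ge0.
have [e Pe Be] := AB o Ao.
by rewrite (bigD1 e) //= Be lerDl sumr_ge0.
Qed.

Lemma prodw_mix S o o' : prodw (mix S o o') * prodw (mix S o' o) = prodw o * prodw o'.
Proof.
rewrite /prodw -!big_split /=; apply: eq_bigr => j _; rewrite !ffunE.
by case: ifP => // _; rewrite mulrC.
Qed.

Lemma mixK S o o' : mix S (mix S o o') (mix S o' o) = o.
Proof. by apply/ffunP => j; rewrite !ffunE; case: (j \in S). Qed.

(* Exchanging the coordinates outside [S] between two independent samples
   preserves their joint law. *)
Lemma sum_mix S (F : {ffun J -> U} -> {ffun J -> U} -> R) :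
  \sum_o \sum_o' prodw o * prodw o' * F (mix S o o') (mix S o' o) =
  \sum_o \sum_o' prodw o * prodw o' * F o o'.
Proof.
rewrite !pair_bigA /=.
pose h (p : {ffun J -> U} * {ffun J -> U}) := (mix S p.1 p.2, mix S p.2 p.1).
have hK : involutive h by case=> o o'; rewrite /h /= !mixK.
rewrite [RHS](reindex h) /=; last by exists h => p _; exact: hK.
by apply: eq_bigr => -[o o'] _ /=; rewrite prodw_mix.
Qed.

(** Pass to two independent samples and exchange their coordinates outside [S]: then [A] reads only
    the first sample and [B] only the second, and the double sum factors. *)
Lemma Pr_indep S A B : depends_on S A -> depends_on (~: S) B ->
  Pr (fun o => A o && B o) = Pr A * Pr B.
Proof.
move=> dA dB; rewrite !PrE mulr_suml.
transitivity (\sum_o \sum_o' prodw o * prodw o' * ((A o)%:R * (B o')%:R)); last first.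
  apply: eq_bigr => o _; rewrite mulr_sumr; apply: eq_bigr => o' _; ring.
transitivity (\sum_o \sum_o' prodw o * prodw o' * (A o && B o)%:R).
  apply: eq_bigr => o _; under eq_bigr do rewrite -mulrA mulrCA.
  rewrite -mulr_suml.
  have <- : Pr xpredT = \sum_o' prodw o' by [].
  by rewrite PrT mul1r.
rewrite -(sum_mix S (fun o _ => (A o && B o)%:R)).
apply: eq_bigr => o _; apply: eq_bigr => o' _; congr (_ * _).
have -> : A (mix S o o') = A o by apply: dA => j jS; rewrite ffunE jS.
have -> : B (mix S o o') = B o'.
  by apply: dB => j; rewrite inE => /negbTE jS; rewrite ffunE jS.
by case: (A o); case: (B o'); rewrite ?mulr1 ?mulr0.
Qed.

(** Conditioning on the coordinates outside [S]: a bound valid for every frozen assignment of them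
    survives averaging. *)
Lemma Pr_cond_le S A (p : R) :
  (forall o', Pr (fun o => A (mix S o o')) <= p) -> Pr A <= p.
Proof.
move=> H.
have -> : Pr A = \sum_o' prodw o' * Pr (fun o => A (mix S o o')).
  rewrite PrE.
  transitivity (\sum_o \sum_o' prodw o * prodw o' * (A o)%:R).
    apply: eq_bigr => o _; under eq_bigr do rewrite -mulrA mulrCA.
    rewrite -mulr_suml.
    have <- : Pr xpredT = \sum_o' prodw o' by [].
    by rewrite PrT mul1r.
  rewrite -(sum_mix S (fun o _ => (A o)%:R)) exchange_big /=.
  apply: eq_bigr => o' _; rewrite PrE mulr_sumr.
  by apply: eq_bigr => o _; ring.
rewrite -[p]mul1r -PrT mulr_suml.
by apply: ler_sum => o _; rewrite ler_wpM2l ?prodw_ge0.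
Qed.

Lemma Pr_all_le (I : eqType) (s : seq I) (S : I -> {set J})
    (A : I -> pred {ffun J -> U}) (p : R) :
  uniq s -> 0 <= p ->
  (forall i, depends_on (S i) (A i)) ->
  (forall i j, i != j -> [disjoint S i & S j]) ->
  (forall i, Pr (A i) <= p) ->
  Pr (fun o => all (fun i => A i o) s) <= p ^+ size s.
Proof.
move=> us p0 dep dis Ap; elim: s us => [_|i s IH /= /andP[nis us]].
  by rewrite expr0 Pr_le1.
rewrite (@Pr_indep (S i)) //; last first.
  move=> o o' oo'; apply: eq_in_all => j js; apply: (dep j) => z zj.
  apply: oo'; rewrite inE; apply: contraL zj => zi.
  have ij : i != j by apply: contraNneq nis => ->.
  by have /disjointFr -> := dis _ _ ij.
by rewrite exprS ler_pM ?Pr_ge0 ?IH.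
Qed.

Section LocalLemma.
Variables (E : finType) (A : E -> pred {ffun J -> U}) (vars : E -> {set J}).
Variables (p : R) (v Delta : nat).
Hypotheses (p_ge0 : 0 <= p) (v_gt0 : (0 < v)%N).
Hypothesis A_dep : forall e, depends_on (vars e) (A e).
Hypothesis A_p : forall e, Pr (A e) <= p.
Hypothesis vars_neq0 : forall e, vars e != set0.
Hypothesis card_vars : forall e, (#|vars e| <= v)%N.
Hypothesis degree : forall j, (#|[set e | j \in vars e]| <= Delta)%N.
Hypothesis small : p * Delta%:R * (4 * v)%:R <= 1.

(** Each variable added to [S] will cost at most a factor [1 - eps] in the probability of [good S];
    with this [eps], [v] variables together cost at most a factor 2. *)
Let eps : R := (2 * v)%:R^-1.
Let good S : pred {ffun J -> U} := fun o => [forall e, (vars e \subset S) ==> ~~ A e o].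

Let eps_bounds : 0 < eps <= 1 / 2.
Proof.
rewrite invr_gt0 ltr0n muln_gt0 v_gt0 /= div1r lef_pV2 ?posrE ?ltr0n ?muln_gt0 ?v_gt0 //.
by rewrite ler_nat; lia.
Qed.

Let expr_eps n : (n <= v)%N -> 1 / 2 <= (1 - eps) ^+ n.
Proof.
case/andP: eps_bounds => e0 e2 nv.
have bern : forall n, 1 - n%:R * eps <= (1 - eps) ^+ n.
  elim=> [|i IH]; first by rewrite mul0r subr0 expr0.
  rewrite exprS -natr1.
  have := ler_wpM2l (_ : 0 <= 1 - eps) IH.
  have i0 : 0 <= i%:R * (eps * eps) by rewrite !mulr_ge0 ?ler0n ?ltW.
  move=> /(_ ltac:(lra)); lra.
apply: le_trans (bern n).
have : n%:R * eps <= v%:R * eps by rewrite ler_wpM2r ?(ltW e0) ?ler_nat.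
have -> : v%:R * eps = 1 / 2.
  rewrite /eps natrM invfM mulrCA mulfV ?mulr1 ?div1r //.
  by rewrite pnatr_eq0 -lt0n.
lra.
Qed.

Let good_dep S : depends_on S (good S).
Proof.
move=> o o' oo'; apply: eq_forallb => e.
have [sub|//] := boolP (vars e \subset S); rewrite /=.
by rewrite (A_dep (o' := o')) // => j /(subsetP sub); exact: oo'.
Qed.

(** Adding [z] to [S0] brings in only events reading [z], at most [Delta] of them. Each is
    independent of [good (S0 :\: vars e)], which by induction is at most twice as likely as
    [good S0], so the relative loss is at most [2 * p * Delta <= eps]. *)
Let good_grow n S S' : (#|S| <= n)%N -> S' \subset S ->
  (1 - eps) ^+ #|S :\: S'| * Pr (good S') <= Pr (good S).
Proof.
case/andP: eps_bounds => e0 e2.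
elim: n S S' => [|n IH] S S' Sn S'S.
  have S0 : S = set0 by apply/eqP; rewrite -cards_eq0; lia.
  by move: S'S; rewrite S0 subset0 => /eqP ->; rewrite setD0 cards0 expr0 mul1r.
have [/eqP|[z zSS']] := set_0Vmem (S :\: S').
  rewrite setD_eq0 => SS'.
  have -> : S = S' by apply/eqP; rewrite eqEsubset SS'.
  by rewrite setDv cards0 expr0 mul1r.
have /andP[zS' zS] : (z \notin S') && (z \in S) by move: zSS'; rewrite inE.
set S0 := S :\ z.
have S0n : (#|S0| <= n)%N by have := cardsD1 z S; rewrite zS /S0; lia.
have S'S0 : S' \subset S0 by rewrite subsetD1 S'S.
have cardS : #|S :\: S'| = #|S0 :\: S'|.+1.
  rewrite (cardsD1 z) zSS' /S0; congr (_.+1); congr #|pred_of_set _|.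
  by apply/setP => j; rewrite !inE; case: (j == z); rewrite ?andbF ?andbT.
apply: (@le_trans _ _ ((1 - eps) * Pr (good S0))).
  by rewrite cardS exprS -mulrA ler_wpM2l ?IH //; lra.
have step e : z \in vars e ->
    Pr (fun o => A e o && good (S0 :\: vars e) o) <= p * (2 * Pr (good S0)).
  move=> ze; rewrite (@Pr_indep (vars e)) //; last first.
    by move=> o o' oo'; apply: good_dep => j; rewrite !inE => /andP[je _]; apply: oo'; rewrite inE.
  apply: ler_pM => //; rewrite ?Pr_ge0 //.
  have := IH S0 (S0 :\: vars e) S0n (subsetDl _ _).
  have : (#|S0 :\: (S0 :\: vars e)| <= v)%N.
    apply: leq_trans (card_vars e); apply: subset_leq_card.
    by apply/subsetP => j; rewrite !inE; case: (j \in vars e) => //=; rewrite andNb.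
  move/expr_eps => h2 /(le_trans _) H.
  have := H (1 / 2 * Pr (good (S0 :\: vars e))) (ler_wpM2r (Pr_ge0 _) h2); lra.
have bad : Pr (good S0) - Pr (good S) <= eps * Pr (good S0).
  rewrite -PrD; last first.
    move=> o /forallP gS; apply/forallP => e; apply/implyP => eS0.
    by have /implyP := gS e; apply; apply: subset_trans eS0 (subD1set _ _).
  apply: (@le_trans _ _ (\sum_(e | z \in vars e) Pr (fun o => A e o && good (S0 :\: vars e) o))).
    apply: le_PrU => o /andP[/forallP g0 /forallPn[e]].
    rewrite negb_imply negbK => /andP[eS Ae]; exists e.
      apply/negPn/negP => ze; have /implyP := g0 e.
      rewrite Ae /= => H; apply: notF; apply: H; by rewrite subsetD1 eS.
    rewrite Ae /=; apply/forallP => e'; apply/implyP => sub.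
    by have /implyP := g0 e'; apply; apply: subset_trans sub (subsetDl _ _).
  apply: (@le_trans _ _ (\sum_(e | z \in vars e) p * (2 * Pr (good S0)))).
    exact: ler_sum.
  rewrite sumr_const -[_ *+ #|_|]mulr_natl.
  have -> : #|(fun e => z \in vars e)| = #|[set e | z \in vars e]| by rewrite cardsE.
  have P0 := Pr_ge0 (good S0).
  apply: (@le_trans _ _ (Delta%:R * (p * (2 * Pr (good S0))))).
    by rewrite ler_wpM2r ?ler_nat // !mulr_ge0.
  have -> : Delta%:R * (p * (2 * Pr (good S0))) = (p * Delta%:R * 2) * Pr (good S0) by ring.
  rewrite ler_wpM2r // /eps -[_^-1]mul1r ler_pdivlMr ?ltr0n ?muln_gt0 ?v_gt0 //.
  by apply: le_trans small; rewrite !natrM; lra.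
lra.
Qed.

Lemma local_lemma : exists o, forall e, ~~ A e o.
Proof.
case/andP: eps_bounds => e0 e2.
have g0 : Pr (good set0) = 1.
  rewrite -PrT; apply: eq_Pr => o; apply/forallP => e; apply/implyP.
  by rewrite subset0 (negbTE (vars_neq0 e)).
have := good_grow (leqnn _) (sub0set setT).
rewrite g0 mulr1 => H.
have : 0 < Pr (good setT) by apply: lt_le_trans H; apply: exprn_gt0; lra.
move=> P0; case: (pickP (good setT)) => [o /forallP go|no].
  by exists o => e; have /implyP := go e; apply; exact: subsetT.
by move: P0; rewrite /Pr big_pred0 // ltxx.
Qed.

End LocalLemma.
End ProductProbability.

(** * Maxima of truncated geometric variables *)

Section TruncatedGeometric.
Variables (R : realFieldType) (q : R) (m : nat).
Hypotheses (q_ge0 : 0 <= q) (q_le1 : q <= 1).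

(** The law of the minimum of [m] and a geometric variable: the whole tail sits on the atom [m]. *)
Definition geomw (u : 'I_m.+1) : R := if (u < m)%N then (1 - q) * q ^+ u else q ^+ m.

Lemma geomw_ge0 u : 0 <= geomw u.
Proof. by rewrite /geomw; case: ifP => _; rewrite ?mulr_ge0 ?exprn_ge0 ?subr_ge0. Qed.

Lemma geomw_sum1 : \sum_u geomw u = 1.
Proof.
rewrite big_ord_recr /= /geomw ltnn.
under eq_bigr => i _ do rewrite /= ltn_ord.
rewrite -mulr_sumr.
elim: m => [|n IH]; first by rewrite big_ord0 mulr0 expr0 add0r.
by rewrite big_ord_recr /= exprS -[RHS]IH; ring.
Qed.

(** Memorylessness up to truncation: moving up by one multiplies a weight by at least [q], and only
    the atom [m], of mass [q ^+ m], has nowhere to move. *)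
Lemma geomw_tail_step (b : pred nat) :
  q * \sum_(u : 'I_m.+1 | b u) geomw u - q ^+ m <=
  \sum_(u : 'I_m.+1 | (0 < u)%N && b u.-1) geomw u.
Proof.
rewrite [X in q * X]big_mkcond big_ord_recr /= [X in _ <= X]big_mkcond big_ord_recl /= add0r.
have last : q * (if b m then geomw ord_max else 0) <= q ^+ m.
  rewrite {1}/geomw ltnn; case: ifP => _; last by rewrite mulr0 exprn_ge0.
  by rewrite ler_piMl ?exprn_ge0.
rewrite mulrDr.
suff : q * (\sum_(i < m) (if b i then geomw (widen_ord (leqnSn m) i) else 0))
    <= \sum_(i < m) (if (0 < bump 0 i)%N && b (bump 0 i).-1 then geomw (lift ord0 i) else 0) by lra.
rewrite mulr_sumr; apply: ler_sum => i _; rewrite /bump /= add0n.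
case: ifP => _; last by rewrite mulr0.
rewrite /geomw /= ltn_ord /bump /= add1n; case: ltnP => [_|mi].
  by rewrite exprS mulrCA.
have -> : q ^+ m = q ^+ i.+1 by congr (_ ^+ _); have := ltn_ord i; lia.
rewrite exprS ler_wpM2l // ler_piMl ?exprn_ge0 ?gerBl //.
Qed.

(* Convexity in [q] of the product of the [1 - q * x z], perturbed by [e]. *)
Lemma prod_onem_convex (I : Type) (s : seq I) (P : pred I) (x y : I -> R) (e : R) :
  0 <= e ->
  (forall z, 0 <= x z <= 1) -> (forall z, 0 <= y z <= 1) ->
  (forall z, q * x z - e <= y z) ->
  \prod_(z <- s | P z) (1 - y z) <=
  1 - q + q * \prod_(z <- s | P z) (1 - x z) + (count P s)%:R * e.
Proof.
have [q0 q1] := conj q_ge0 q_le1.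
move=> e0 x01 y01 xy; elim: s => [|z s IH]; first by rewrite !big_nil /= mul0r; lra.
rewrite !big_cons /=; case: ifP => _; last by rewrite add0n.
set A := \prod_(_ <- _ | _) _ in IH *; set B := \prod_(_ <- _ | _) _ in IH *.
rewrite add1n -natr1; set c := (count P s)%:R in IH *.
have A01 : 0 <= A <= 1.
  apply/andP; split.
    by apply: prodr_ge0 => j _; have := y01 j; lra.
  by apply: prodr_ile1 => j _; have := y01 j; lra.
have B01 : 0 <= B <= 1.
  apply/andP; split.
    by apply: prodr_ge0 => j _; have := x01 j; lra.
  by apply: prodr_ile1 => j _; have := x01 j; lra.
have c0 : 0 <= c by rewrite ler0n.
have := xy z; have := x01 z; have := y01 z; set X := x z; set Y := y z => Y01 X01 XY.
have h1 : (1 - Y) * A <= (1 - q * X + e) * A by rewrite ler_wpM2r; lra.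
have h2 : e * A <= e by rewrite ler_piMr; lra.
have qX : 0 <= q * X <= 1.
  by rewrite mulr_ge0 ?mulr_ile1 //; lra.
have h3 : (1 - q * X) * A <= (1 - q * X) * (1 - q + q * B + c * e).
  by rewrite ler_wpM2l //; lra.
have h4 : 0 <= q * X * (c * e) by rewrite !mulr_ge0 //; lra.
have h5 : 0 <= q * X * ((1 - q) * (1 - B)) by rewrite !mulr_ge0 //; lra.
lra.
Qed.

(** The event puts the maximum of the shifted variables in a window of length [tau]. Its probability
    is a difference of two products; raising the threshold by [tau] shifts each variable by one, so
    [geomw_tail_step] compares the factors and [prod_onem_convex] the products. *)
Lemma max_anticoncentration (J : finType) (N : {set J}) (c : J -> R) (tau a : R) :
  0 < tau ->
  @Pr R J _ geomw (fun o => [forall z, (z \in N) ==> (tau * (o z)%:R + c z < a + tau)]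
                   && ~~ [forall z, (z \in N) ==> (tau * (o z)%:R + c z < a)])
  <= 1 - q + #|N|%:R * q ^+ m.
Proof.
have [q0 q1] := conj q_ge0 q_le1.
move=> tau0; rewrite PrD; last first.
  move=> o /forallP H; apply/forallP => z; apply/implyP => zN.
  by have /implyP/(_ zN) := H z; lra.
rewrite !(Pr_box geomw (fun z u => (z \in N) ==> (tau * (u : nat)%:R + c z < _))).
pose x z : R := \sum_(u : 'I_m.+1 | a <= tau * (u : nat)%:R + c z) geomw u.
pose y z : R := \sum_(u : 'I_m.+1 | a + tau <= tau * (u : nat)%:R + c z) geomw u.
have sumC (P : pred 'I_m.+1) : \sum_(u | ~~ P u) geomw u = 1 - \sum_(u | P u) geomw u.
  by rewrite -geomw_sum1 [X in X - _](bigID P) /=; ring.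
have sum01 (P : pred 'I_m.+1) : 0 <= \sum_(u | P u) geomw u <= 1.
  have h : 0 <= \sum_(u | ~~ P u) geomw u by apply: sumr_ge0 => u _; exact: geomw_ge0.
  rewrite sumC in h; apply/andP; split; last by lra.
  by apply: sumr_ge0 => u _; exact: geomw_ge0.
have prodE b : \prod_z \sum_(u : 'I_m.+1 | (z \in N) ==> (tau * (u : nat)%:R + c z < b)) geomw u
   = \prod_(z in N) (1 - \sum_(u : 'I_m.+1 | b <= tau * (u : nat)%:R + c z) geomw u).
  rewrite [RHS]big_mkcond /=; apply: eq_bigr => z _; case: (z \in N) => /=.
    by rewrite -sumC; apply: eq_bigl => u; rewrite ltNge.
  by rewrite geomw_sum1.
rewrite !prodE -/(x _) -/(y _).
have xy z : q * x z - q ^+ m <= y z.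
  apply: le_trans (geomw_tail_step (fun u => a <= tau * u%:R + c z)) _.
  rewrite /y [X in X <= _]big_mkcond [X in _ <= X]big_mkcond; apply: ler_sum => u _ /=.
  case: ifP => [/andP[u0 ua]|_]; last by case: ifP => // _; exact: geomw_ge0.
  suff -> : a + tau <= tau * (u : nat)%:R + c z by [].
  have : (u : nat)%:R = (u : nat).-1%:R + 1 :> R by rewrite natr1 prednK.
  by move=> ->; lra.
have := @prod_onem_convex _ (index_enum J) (mem N) x y (q ^+ m) (exprn_ge0 _ q_ge0)
  (fun z => sum01 _) (fun z => sum01 _) xy.
have -> : count (mem N) (index_enum J) = #|N|.
  by rewrite cardE /enum_mem size_filter; apply: eq_count.
set A := \prod_(_ <- _ | _) _; set B := \prod_(_ <- _ | _) _.
have B01 : 0 <= B <= 1.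
  apply/andP; split.
    by apply: prodr_ge0 => j _; have := sum01 (fun u => a <= tau * (u : nat)%:R + c j); rewrite /x; lra.
  by apply: prodr_ile1 => j _; have := sum01 (fun u => a <= tau * (u : nat)%:R + c j); rewrite /x; lra.
have : q * B <= B by rewrite ler_piMl; lra.
lra.
Qed.

End TruncatedGeometric.

(** * Separation at one scale *)

Section Doubling.
Variables (R : realType) (k : nat) (d : 'I_k -> 'I_k -> R) (K : nat).
Hypotheses (d_metric : is_metric d) (d_doubling : doubling_ok d K).

Lemma doubling_cover n i (r : R) : 0 < r ->
  exists C : {set 'I_k}, (#|C| <= K ^ n)%N /\
    forall j, d i j < r -> exists2 c, c \in C & d c j < r / 2 ^+ n.
Proof.
move=> r0; elim: n => [|n [C [Cn HC]]].
  exists [set i]; split; first by rewrite cards1.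
  by move=> j ij; exists i; rewrite ?inE // expr0 divr1.
have r'0 : 0 < r / 2 ^+ n by rewrite divr_gt0 ?exprn_gt0.
have [f Hf] := fin_all_exists (fun c => d_doubling c r'0).
exists (\bigcup_(c in C) f c); split.
  apply: (@leq_trans (\sum_(c in C) K)%N).
    elim/big_rec2: _ => [|c s S _ Ss]; first by rewrite cards0.
    by apply: leq_trans (leq_card_setU _ _) (leq_add _ Ss); have [] := Hf c.
  by rewrite sum_nat_const expnSr leq_mul2r Cn orbT.
move=> j /HC[c cC cj]; have [_ /(_ j cj)[c' c'f c'j]] := Hf c.
exists c'; first by apply/bigcupP; exists c.
by rewrite exprSr invfM mulrA.
Qed.

(** A covering ball of radius at most [rho / 2] catches at most one point of [S], so sending points
    to centres is injective. *)
Lemma separated_card (S : {set 'I_k}) (rho r : R) n x :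
  0 < r ->
  (forall y z, y \in S -> z \in S -> y != z -> rho <= d y z) ->
  r / 2 ^+ n <= rho / 2 ->
  (#|[set y in S | (d x y < r)%R]| <= K ^ n)%N.
Proof.
case: d_metric => _ _ dC dT r0 sepS rn.
have [C [Cn HC]] := doubling_cover n x r0.
pose g y := odflt y [pick c in C | d c y < r / 2 ^+ n].
have gP y : d x y < r -> (g y \in C) /\ d (g y) y < r / 2 ^+ n.
  rewrite /g => xy; case: pickP => [c /andP[] //|/= H].
  by have [c cC cy] := HC y xy; have := H c; rewrite cC cy.
apply: leq_trans Cn; rewrite -(card_in_imset (f := g)).
  apply: subset_leq_card; apply/subsetP => c /imsetP[y]; rewrite inE => /andP[_ xy] ->.
  by have [] := gP y xy.
move=> y z; rewrite !inE => /andP[yS xy] /andP[zS xz] gyz.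
apply/eqP/negPn/negP => yz.
have [_ h1] := gP y xy; have [_ h2] := gP z xz.
have := sepS y z yS zS yz; have := dT y (g y) z; rewrite (dC y (g y)).
rewrite -gyz in h2; lra.
Qed.

(** A maximal separated set covers: a point far from all of it could be added. *)
Lemma net_exists (rho : R) : 0 < rho ->
  exists S : {set 'I_k},
    (forall y z, y \in S -> z \in S -> y != z -> rho <= d y z) /\
    (forall x, exists2 y, y \in S & d x y < rho).
Proof.
case: d_metric => d0 dE dC dT rho0.
pose sepb (S : {set 'I_k}) :=
  [forall y in S, forall z in S, (y != z) ==> (rho <= d y z)].
have [S /maxsetP[sepS maxS]] : {S | maxset sepb S}.
  by apply: ex_maxset; exists set0; apply/forall_inP => y; rewrite inE.
have sepP y z : y \in S -> z \in S -> y != z -> rho <= d y z.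
  by move=> yS zS; move/forall_inP/(_ y yS)/forall_inP/(_ z zS)/implyP: sepS; apply.
exists S; split=> // x.
have [xS|xS] := boolP (x \in S).
  by exists x => //; have /(dE x x).2 -> : x = x by [].
have [/existsP[y /andP[yS xy]]|] := boolP [exists y, (y \in S) && (d x y < rho)].
  by exists y.
move=> /existsPn far; case/negP: xS.
suff <- : x |: S = S by rewrite !inE eqxx.
apply: maxS; last exact: subsetUr.
have far' y : y \in S -> rho <= d x y by move=> yS; have := far y; rewrite yS -leNgt.
apply/forall_inP => y; rewrite !inE => /orP[/eqP ->|yS]; apply/forall_inP => z;
  rewrite !inE => /orP[/eqP ->|zS]; apply/implyP => yz; rewrite ?eqxx in yz => //.
- exact: far'.
- by rewrite dC far'.
- exact: sepP.
Qed.

Section Stage.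
Variables (D m n : nat) (q L r : R) (H : 'I_D -> 'I_k -> R).
(** Bound on the probability that one coordinate fails on a given pair; [K ^ 3] bounds the number of
    net points within [3 * r]. *)
Let p : R := 1 - q + (K ^ 3)%:R * q ^+ m.
Hypotheses (K_gt0 : (0 < K)%N) (m_gt0 : (0 < m)%N) (D_gt0 : (0 < D)%N).
Hypotheses (q_ge0 : 0 <= q) (q_le1 : q <= 1) (r_gt0 : 0 < r) (L_ge0 : 0 <= L).
(** After [n] halvings a ball of radius [(L + 6) * r] has shrunk to half the granularity
    [r / (16 * m)] of the fine net, so [K ^ n * K ^ n] bounds the number of events reading a given
    variable. *)
Hypothesis n_large : (L + 6) * (32 * m)%:R <= 2 ^+ n.
Hypothesis small : p ^+ D * (K ^ n * K ^ n)%:R * (4 * (2 * K ^ 3 * D))%:R <= 1.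
Hypothesis H_lip : forall i x y, `|H i x - H i y| <= d x y.

(* The bump functions are maxima of cones whose random heights follow a
   truncated geometric law; the local lemma is applied to the events that a
   pair of points of a fine net is not separated by any coordinate. *)
Lemma separating_bumps : exists phi : 'I_D -> 'I_k -> R,
  [/\ forall i x, 0 <= phi i x <= 2 * r,
      forall i x y, `|phi i x - phi i y| <= d x y &
      forall x y, 8 * r <= d x y <= L * r ->
        exists i, r / (4 * m)%:R <= `|(H i x + phi i x) - (H i y + phi i y)|].
Proof.
have [r0 [q0 q1]] := conj r_gt0 (conj q_ge0 q_le1).
have [d0 dE dC dT] := d_metric.
have dxx x : d x x = 0 by apply: (dE x x).2.
have [Z [sepZ coverZ]] := net_exists r0.
have M1 : 1 <= m%:R :> R by rewrite (ler_nat _ 1).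
set M : R := m%:R in M1.
(* Granularity of the fine net, a sixteenth of the height step [tau]. *)
have del0 : 0 < r / (16 * M) by rewrite divr_gt0 //; lra.
set del := r / (16 * M) in del0.
have delM : 16 * M * del = r by rewrite /del mulrCA divff ?mulr1 //; apply/eqP; lra.
have tau0 : 0 < r / M by rewrite divr_gt0 //; lra.
set tau := r / M in tau0.
have tauM : tau * M = r by rewrite /tau divfK //; apply/eqP; lra.
have del_tau : tau = 16 * del.
  apply: (@mulIf _ M); first by apply/eqP; lra.
  by rewrite tauM -delM; ring.
have del_r : 16 * del <= r by rewrite -delM -mulrA ler_wpM2l // ler_peMl // ltW.
have [Y [sepY coverY]] := net_exists del0.
(* Heights are at most [2 * r], so a cone centred at distance [3 * r] or more is negative at [x] and
   can be ignored; thus the value at [x] depends on few variables. *)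
pose N x := [set z in Z | d x z < 3 * r].
have cardN x : (#|N x| <= K ^ 3)%N.
  by apply: separated_card sepZ _; lra.
pose phi (o : {ffun 'I_k * 'I_D -> 'I_m.+1}) i x :=
  \big[Num.max/0]_(z in N x) (tau * (o (z, i) : nat)%:R + (r - d x z)).
have term_le (o : {ffun 'I_k * 'I_D -> 'I_m.+1}) j : tau * (o j : nat)%:R <= r.
  by rewrite -tauM; apply: ler_wpM2l; [exact: ltW|rewrite ler_nat -ltnS].
have term_ge (o : {ffun 'I_k * 'I_D -> 'I_m.+1}) j : 0 <= tau * (o j : nat)%:R.
  by rewrite mulr_ge0 ?ler0n // ltW.
have phi0 o i x : 0 <= phi o i x by apply: bigmax_ge_id.
have phi2 o i x : phi o i x <= 2 * r.
  apply: bigmax_le => [|z _]; first by lra.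
  by have := term_le o (z, i); have := d0 x z; lra.
have phiL o i x y : phi o i x <= phi o i y + d x y.
  apply: bigmax_le => [|z]; first by rewrite addr_ge0.
  rewrite inE => /andP[zZ _].
  have xyz := dT y x z; rewrite (dC y x) in xyz.
  have [zy|zy] := ltP (d y z) (3 * r).
    have : tau * (o (z, i) : nat)%:R + (r - d y z) <= phi o i y.
      by apply: (le_bigmax_cond 0 (fun z => tau * (o (z, i) : nat)%:R + (r - d y z)));
        rewrite inE zZ.
    lra.
  by have := term_le o (z, i); have := phi0 o i y; lra.
have phi_lip o i x y : `|phi o i x - phi o i y| <= d x y.
  by rewrite ler_norml; have := phiL o i x y; have := phiL o i y x; rewrite (dC y x); lra.
(* Room is left for rounding to the fine net; the bound [6 * r] makes [N e.1] and [N e.2]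
   disjoint. *)
pose valid (e : 'I_k * 'I_k) :=
  [&& e.1 \in Y, e.2 \in Y, 6 * r <= d e.1 e.2 & d e.1 e.2 <= (L + 1) * r].
pose bad (e : {e | valid e}) (o : {ffun 'I_k * 'I_D -> 'I_m.+1}) :=
  [forall i, `|(H i (val e).1 + phi o i (val e).1) - (H i (val e).2 + phi o i (val e).2)| < tau / 2].
pose vars (e : {e | valid e}) := setX (N (val e).1 :|: N (val e).2) [set: 'I_D].
have phi_dep (o o' : {ffun 'I_k * 'I_D -> 'I_m.+1}) i x : (forall z, z \in N x -> o (z, i) = o' (z, i)) -> phi o i x = phi o' i x.
  by move=> oo'; apply: eq_bigr => z zN; rewrite oo'.
have N0 x : exists2 z, z \in N x & d x z < r.
  by have [z zZ xz] := coverZ x; exists z => //; rewrite inE zZ; lra.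
have p0 : 0 <= p by rewrite /p addr_ge0 ?mulr_ge0 ?exprn_ge0 ?ler0n // subr_ge0.
have [||||||||o Ho] := @local_lemma R _ _ (geomw q (m:=m)) (@geomw_ge0 R q m q0 q1) (geomw_sum1 q m)
    {e | valid e} bad vars (p ^+ D) (2 * K ^ 3 * D) (K ^ n * K ^ n).
- exact: exprn_ge0.
- by rewrite muln_gt0 D_gt0 muln_gt0 /= expn_gt0 K_gt0.
- move=> e o o' oo'; apply: eq_forallb => i.
  by rewrite !(phi_dep o o') // => z zN; apply: oo'; rewrite in_setX in_setU in_setT zN ?orbT.
- move=> [[x y] xyv]; case/and4P: (xyv) => /= xY yY xy _; rewrite /bad /=.
  have disj z : z \in N x -> z \in N y -> False.
    rewrite !inE => /andP[_ xz] /andP[_ yz]; have := dT x z y; rewrite (dC z y); lra.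
  (* Freezing the heights outside [N x] fixes the value at [y]; failure of coordinate [i] then
     confines [phi o i x] to the window from [a i] to [a i + tau]. *)
  apply: (@Pr_cond_le _ _ _ _ (@geomw_ge0 R q m q0 q1) (geomw_sum1 q m) (setX (N x) [set: 'I_D])) => o'.
  pose c (j : 'I_k * 'I_D) := r - d x j.1.
  pose a i := H i y + phi o' i y - H i x - tau / 2.
  pose S i : {set 'I_k * 'I_D} := setX (N x) [set i].
  pose B i (o : {ffun 'I_k * 'I_D -> 'I_m.+1}) :=
    [forall j, (j \in S i) ==> (tau * (o j : nat)%:R + c j < a i + tau)]
    && ~~ [forall j, (j \in S i) ==> (tau * (o j : nat)%:R + c j < a i)].
  apply: (@le_trans _ _ (Pr (geomw q (m:=m)) (fun o => all (fun i => B i o) (enum 'I_D)))); last first.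
    have -> : p ^+ D = p ^+ size (enum 'I_D) by rewrite -cardE card_ord.
    apply: (Pr_all_le (@geomw_ge0 R q m q0 q1) (geomw_sum1 q m) (S := S)) => //.
    + exact: enum_uniq.
    + move=> i o o1 oo1; congr (_ && ~~ _); apply: eq_forallb => j;
      by case jS : (j \in S i) => //=; rewrite oo1.
    + move=> i i' ii'; rewrite -setI_eq0; apply/eqP/setP => -[z j]; rewrite !inE /=.
      apply/negP => /andP[/andP[_ /eqP ->] /andP[_ /eqP E]].
      by rewrite E eqxx in ii'.
    + move=> i; apply: le_trans (max_anticoncentration m q0 q1 (S i) c (a i) tau0) _.
      rewrite /p lerD2l ler_wpM2r ?exprn_ge0 // ler_nat.
      by rewrite cardsX cards1 muln1.
  apply: le_Pr => [|o /forallP bo]; first exact: geomw_ge0.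
  apply/allP => i _; have {bo} := bo i; rewrite ltr_norml => /andP[lo hi].
  have Ey : phi (mix (setX (N x) [set: 'I_D]) o o') i y = phi o' i y.
    apply: phi_dep => z zy; rewrite ffunE; case: ifP => //; rewrite !inE /= => zx.
    by case: (disj z) => //; move: zx; rewrite andbT inE.
  have Ex : phi (mix (setX (N x) [set: 'I_D]) o o') i x = phi o i x.
    apply: phi_dep => z zx; rewrite ffunE; case: ifP => //; rewrite in_setX in_setT andbT.
    by rewrite zx.
  rewrite Ex Ey in lo hi; apply/andP; split.
    apply/forallP => -[z i']; apply/implyP; rewrite in_setX in_set1 => /andP[/= zN /eqP ->].
    apply: le_lt_trans (_ : phi o i x < _); last by rewrite /a; lra.
    exact: (le_bigmax_cond 0 (fun z => tau * (o (z, i) : nat)%:R + (r - d x z))).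
  apply/negP => /forallP small_o.
  have term z : z \in N x -> tau * (o (z, i) : nat)%:R + (r - d x z) < a i.
    by move=> zN; have /implyP := small_o (z, i); apply; rewrite in_setX in_set1 zN /=.
  suff : phi o i x < a i by rewrite /a; lra.
  apply: bigmax_lt => [|z]; last exact: term.
  (* The default value 0 of the maximum must lie below [a i] too: the cone of a net point within [r]
     is positive at [x]. *)
  have [z zN xz] := N0 x; have := term z zN; have := term_ge o (z, i); lra.
- move=> [[x y] xy]; apply/set0Pn; have [z zN _] := N0 x.
  by exists (z, Ordinal D_gt0); rewrite !inE /=; move: zN; rewrite inE => ->.
- move=> e; rewrite cardsX cardsT card_ord leq_mul2r.
  apply/orP; right; apply: leq_trans (leq_card_setU _ _) _.
  by rewrite mul2n -addnn leq_add.
- move=> [z i]; set V := [set y in Y | d z y < (L + 6) * r].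
  have VK : (#|V| <= K ^ n)%N.
    apply: separated_card sepY _; first by rewrite mulr_gt0 ?ltr_wpDl.
    rewrite ler_pdivrMr ?exprn_gt0 //.
    have := ler_wpM2l (ltW del0) n_large.
    rewrite natrM -/M -[X in X * r]mulr1 -delM; lra.
  apply: (@leq_trans #|setX V V|); last by rewrite cardsX leq_mul.
  rewrite -(card_imset _ val_inj); apply: subset_leq_card.
  apply/subsetP => e /imsetP[[[x y] xyv]]; rewrite inE /vars /= => zv ->.
  case/and4P: (xyv) => /= xY yY _ xy; rewrite !inE /= xY yY /=.
  move: zv; rewrite !inE /= andbT => /orP[] /andP[_ dz];
  have := dT z x y; have := dT z y x; rewrite (dC z x) (dC z y) (dC y x); lra.
- exact: small.
exists (phi o); split=> [i x|i x y|x y /andP[lo hi]]; [by rewrite phi0 phi2|exact: phi_lip|].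
have [x' x'Y xx'] := coverY x; have [y' y'Y yy'] := coverY y.
have val_xy : valid (x', y').
  rewrite /valid /= x'Y y'Y /=.
  have := dT x x' y; have := dT x' y' y; have := dT x' x y'; have := dT x y y'.
  by rewrite (dC y' y) (dC x' x); lra.
have /forallPn[i] := Ho (exist _ (x', y') val_xy); rewrite -leNgt /= => sep_i.
exists i; move: (H_lip i x x') (H_lip i y y') (phi_lip o i x x') (phi_lip o i y y') sep_i.
have -> : r / (4 * m)%:R = tau / 4 by rewrite natrM -/M /tau; field; apply/eqP; lra.
move: (H i x) (H i x') (H i y) (H i y') (phi o i x) (phi o i x') (phi o i y) (phi o i y').
move=> a1 a2 a3 a4 a5 a6 a7 a8 h1 h2 h3 h4 h5.
(* Rounding both points costs at most [4 * del = tau / 4] of the separation [tau / 2]. *)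
have : `|a2 + a6 - (a4 + a8)| <= `|a1 + a5 - (a3 + a7)| + `|a1 - a2| + `|a5 - a6| + `|a3 - a4| + `|a7 - a8|.
  rewrite (_ : a2 + a6 - (a4 + a8) = (a1 + a5 - (a3 + a7)) - (a1 - a2) - (a5 - a6) + (a3 - a4) + (a7 - a8)); last by ring.
  do 4?[apply: le_trans (ler_normD _ _) _; rewrite ?normrN lerD2r].
  exact: lexx.
lra.
Qed.

End Stage.
End Doubling.

(** * Summation over the scales *)

Section Multiscale.
Variables (R : realType) (k D : nat) (d : 'I_k -> 'I_k -> R) (mu M : R).
Hypotheses (d_metric : is_metric d) (mu_ge2 : 2 <= mu) (M_gt0 : 0 < M).
Hypothesis mu_M : 32 * M <= mu ^+ 3.
Hypothesis stage : forall (r : R) (H : 'I_D -> 'I_k -> R), 0 < r ->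
  (forall i x y, `|H i x - H i y| <= d x y) ->
  exists phi : 'I_D -> 'I_k -> R,
  [/\ forall i x, 0 <= phi i x <= 2 * r,
      forall i x y, `|phi i x - phi i y| <= d x y &
      forall x y, 8 * r <= d x y <= 8 * mu ^+ 4 * r ->
        exists i, r / (4 * M) <= `|(H i x + phi i x) - (H i y + phi i y)|].

(* [rho] is the fourth root of the next scale to be treated. The last two
   clauses leave room for the total contribution [4 * rho ^+ 3] of the scales
   still to come. *)
Definition partial_embedding (rho : R) (f : 'I_D -> 'I_k -> R) :=
  [/\ forall i x y, `|f i x - f i y| * rho <= d x y,
      forall i x y e, e ^+ 4 = d x y -> rho < e ->
        `|f i x - f i y| <= 8 * e ^+ 3 - 4 * rho ^+ 3 &
      forall x y, 8 * (mu * rho) ^+ 4 <= d x y -> exists i s,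
        [/\ 0 < s, d x y <= 8 * mu ^+ 4 * s ^+ 4 &
            s ^+ 3 / (8 * M) + 4 * rho ^+ 3 <= `|f i x - f i y|]].

Lemma partial_embedding_step rho f : 0 < rho -> partial_embedding rho f ->
  exists f', partial_embedding (rho / mu) f'.
Proof.
move=> rho0 [lip up lo].
have [M0 [mu2 muM]] := conj M_gt0 (conj mu_ge2 mu_M).
have [d0 _ _ _] := d_metric.
have mu0 : mu != 0 by apply/eqP; lra.
have r0 : rho != 0 by apply/eqP; lra.
have r4 : 0 < rho ^+ 4 by apply: exprn_gt0.
have r3 : 0 < rho ^+ 3 by apply: exprn_gt0.
set rho' := rho / mu.
have rho'mu : mu * rho' = rho by rewrite /rho' mulrC divfK.
have rho'0 : 0 < rho' by rewrite divr_gt0 //; lra.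
have rho'2 : 2 * rho' <= rho by rewrite -rho'mu ler_wpM2r //; lra.
have rho'3 : mu ^+ 3 * rho' ^+ 3 = rho ^+ 3 by rewrite -exprMn rho'mu.
have r'3 : 0 < rho' ^+ 3 by apply: exprn_gt0.
have rho'32 : 32 * M * rho' ^+ 3 <= rho ^+ 3 by rewrite -rho'3 ler_wpM2r // ltW.
have mu8 : 8 <= mu ^+ 3.
  rewrite (_ : 8 = 2 ^+ 3); last by ring.
  by rewrite ler_pXn2r ?nnegrE //; lra.
have rho'8 : 8 * rho' ^+ 3 <= rho ^+ 3 by rewrite -rho'3 ler_wpM2r // ltW.
(* The bumps of scale [rho ^+ 4] enter with weight [1 / rho], so the coarser part offered to [stage]
   is [f * rho], 1-Lipschitz by the first clause. *)
have [|phi [phi2 phi_lip phi_sep]] := @stage (rho ^+ 4) (fun i x => f i x * rho) r4.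
  by move=> i x y; rewrite -mulrBl normrM (gtr0_norm rho0).
pose f' i x := f i x + phi i x / rho.
have f'E i x y : f' i x - f' i y = (f i x - f i y) + (phi i x - phi i y) / rho.
  by rewrite /f'; field.
have dphi i x y : `|(phi i x - phi i y) / rho| * rho = `|phi i x - phi i y|.
  by rewrite normrM normfV (gtr0_norm rho0) divfK.
have dphi2 i x y : `|(phi i x - phi i y) / rho| <= 2 * rho ^+ 3.
  rewrite -(ler_pM2r rho0) dphi -mulrA -exprSr.
  by rewrite ler_norml; have := phi2 i x; have := phi2 i y; lra.
have lip' i x y : `|f' i x - f' i y| * rho <= 2 * d x y.
  rewrite f'E; have := ler_normD (f i x - f i y) ((phi i x - phi i y) / rho).
  move=> /(ler_wpM2r (ltW rho0)); rewrite [X in _ <= X]mulrDl dphi.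
  by have := lip i x y; have := phi_lip i x y; lra.
exists f'; split.
- move=> i x y; rewrite -/rho'.
  have := ler_wpM2l (normr_ge0 (f' i x - f' i y)) rho'2.
  by have := lip' i x y; lra.
- move=> i x y e eE rho'e; rewrite -/rho' in rho'e *.
  have e3 : rho' ^+ 3 <= e ^+ 3 by rewrite ler_pXn2r ?nnegrE //; lra.
  (* Above [rho] the bump adds at most [2 * rho ^+ 3], which the reserve absorbs; at or below it the
     Lipschitz bound alone gives [2 * e ^+ 3]. *)
  have [rhoe|erho] := ltP rho e.
    have := up i x y e eE rhoe; have := dphi2 i x y.
    by rewrite f'E; have := ler_normD (f i x - f i y) ((phi i x - phi i y) / rho); lra.
  have e0 : 0 < e by lra.
  have : `|f' i x - f' i y| * rho <= 2 * e ^+ 3 * rho.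
    apply: le_trans (lip' i x y) _; rewrite -eE -mulrA ler_wpM2l // exprSr.
    by rewrite ler_wpM2l // exprn_ge0 // ltW.
  by rewrite ler_pM2r //; lra.
- move=> x y; rewrite -/rho' rho'mu => d8.
  (* Pairs of the new scale gain [rho ^+ 3 / (4 * M)], half of which becomes the reserve. For
     farther pairs the bump uses up at most half of the old reserve. *)
  have [dle|dgt] := leP (d x y) (8 * mu ^+ 4 * rho ^+ 4).
    have [|i sep_i] := phi_sep x y; first by rewrite d8 dle.
    exists i, rho; split=> //.
    rewrite -(ler_pM2r rho0).
    have -> : `|f' i x - f' i y| * rho = `|f i x * rho + phi i x - (f i y * rho + phi i y)|.
      rewrite -[in LHS](gtr0_norm rho0) -normrM /f'; congr `|_|; by field.
    apply: le_trans sep_i; rewrite [X in _ <= X](_ : _ = rho ^+ 3 / (4 * M) * rho); last first.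
      by field; apply/eqP; lra.
    rewrite ler_pM2r //.
    have -> : rho ^+ 3 / (4 * M) = rho ^+ 3 / (8 * M) + rho ^+ 3 / (8 * M).
      by field; apply/eqP; lra.
    by rewrite lerD2l ler_pdivlMr; lra.
  have [|i [s [s0 ds fs]]] := lo x y; first by rewrite exprMn mulrA ltW.
  exists i, s; split=> //.
  have := dphi2 i x y; rewrite f'E.
  have := ler_normD ((f i x - f i y) + (phi i x - phi i y) / rho) (- ((phi i x - phi i y) / rho)).
  by rewrite addrK normrN; lra.
Qed.

(** The induction starts from the zero map, at a scale so large that the separation clause is
    void. *)
Lemma partial_embedding_exists rho T : 0 < rho ->
  (forall x y, d x y < 8 * (mu * rho) ^+ 4) ->
  exists f, partial_embedding (rho / mu ^+ T) f.
Proof.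
have [M0 mu2] := conj M_gt0 mu_ge2.
move=> rho0 diam_rho; elim: T => [|T [f Hf]].
  exists (fun _ _ => 0); rewrite expr0 divr1; split.
  - by move=> i x y; rewrite subrr normr0 mul0r; case: d_metric.
  - move=> i x y e _ rhoe; rewrite subrr normr0.
    have : rho ^+ 3 <= e ^+ 3 by rewrite ler_pXn2r ?nnegrE //; lra.
    have : 0 < rho ^+ 3 by apply: exprn_gt0.
    lra.
  - by move=> x y; rewrite leNgt diam_rho.
have rT : 0 < rho / mu ^+ T by rewrite divr_gt0 ?exprn_gt0 //; lra.
by rewrite exprSr invfM mulrA; exact: partial_embedding_step Hf.
Qed.

(** For [e] the fourth root of the distance, the upper bound [8 * e ^+ 3] has power [4 / 3] equal to
    [16 * e ^+ 4]. The lower bound [s ^+ 3 / (8 * M)] is at least [(s / mu) ^+ 3], which accounts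
    for [mu ^+ 8]. *)
Lemma snowflake_embedding : exists f : 'I_D -> 'I_k -> R,
  (forall i x y, `|f i x - f i y| `^ (4 / 3) <= 16 * d x y) /\
  (forall x y, x != y ->
     exists i, d x y <= 8 * mu ^+ 8 * `|f i x - f i y| `^ (4 / 3)).
Proof.
have [M0 [mu2 muM]] := conj M_gt0 (conj mu_ge2 mu_M).
have [d0 dE _ _] := d_metric.
have mu0 : 0 < mu by lra.
have pow43 (x : R) : 0 <= x -> (x ^+ 3) `^ (4 / 3) = x ^+ 4.
  move=> x0; rewrite -[x ^+ 3]powR_mulrn // -powRrM.
  by rewrite (_ : 3%:R * (4 / 3) = 4%:R :> R) ?powR_mulrn //; field.
have mono (x y : R) : 0 <= x -> x <= y -> x `^ (4 / 3) <= y `^ (4 / 3).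
  move=> x0 xy; apply: ge0_ler_powR; rewrite ?nnegrE //; lra.
have root4 x y : (d x y `^ 4^-1) ^+ 4 = d x y.
  by rewrite -powR_mulrn ?powR_ge0 // -powRrM mulVf ?powRr1 // pnatr_eq0.
pose big := \sum_x \sum_y d x y.
have big_ge x y : d x y <= big.
  rewrite /big (bigD1 x) //= (bigD1 y) //= -addrA lerDl.
  by rewrite addr_ge0 ?sumr_ge0 // => z _; rewrite ?sumr_ge0.
have big0 : 0 <= big by apply: sumr_ge0 => x _; apply: sumr_ge0.
pose rho := 1 + big.
have rho_gt : forall x y, d x y < 8 * (mu * rho) ^+ 4.
  move=> x y; apply: (@le_lt_trans _ _ (mu * rho)).
    apply: le_trans (big_ge x y) _; rewrite /rho.
    have : 1 * (1 + big) <= mu * (1 + big) by rewrite ler_wpM2r //; lra.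
    lra.
  have : 1 <= mu * rho by rewrite -[1]mul1r ler_pM //; rewrite /rho; lra.
  move=> h1; have := ler_eXnr (_ : (0 < 4)%N) h1 => /(_ isT).
  lra.
have rho0 : 0 < rho by rewrite /rho; lra.
(* The space is finite, so finitely many scales go below every non-zero distance. *)
have [T HT] : exists T, forall x y, x != y -> 8 * (mu * (rho / mu ^+ T)) ^+ 4 < d x y /\
    rho / mu ^+ T < d x y `^ 4^-1.
  pose ev x y := d x y `^ 4^-1.
  pose del := \sum_x \sum_y (ev x y)^-1.
  have ev0 x y : 0 <= (ev x y)^-1 by rewrite invr_ge0 powR_ge0.
  have del_ge x y : (ev x y)^-1 <= del.
    rewrite /del (bigD1 x) //= (bigD1 y) //= -addrA lerDl.
    by rewrite addr_ge0 ?sumr_ge0 // => z _; rewrite ?sumr_ge0.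
  have del0 : 0 <= del by apply: sumr_ge0 => x _; apply: sumr_ge0.
  have X0 : 0 <= 2 * mu * rho * del by rewrite !mulr_ge0 // ltW.
  have [T XT] : exists T, 2 * mu * rho * del < mu ^+ T.
    exists (Num.bound (2 * mu * rho * del)).
    apply: lt_trans (archi_boundP X0) _; apply: (@lt_le_trans _ _ (2 ^+ Num.bound (2 * mu * rho * del))).
      by rewrite -natrX ltr_nat ltn_expl.
    by rewrite lerXn2r ?nnegrE //; lra.
  exists T => x y xy.
  have ev_gt0 : 0 < ev x y.
    by apply: powR_gt0; rewrite lt_neqAle d0 andbT eq_sym; apply/eqP => /dE /eqP; exact/negP.
  have muT : 0 < mu ^+ T by apply: exprn_gt0.
  have small_e : 2 * (mu * (rho / mu ^+ T)) < ev x y.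
    rewrite !mulrA ltr_pdivrMr //.
    have h1 : 1 <= del * ev x y by rewrite -ler_pdivrMr // div1r.
    have h2 : 2 * mu * rho * 1 <= 2 * mu * rho * (del * ev x y).
      by rewrite ler_wpM2l // !mulr_ge0 // ltW.
    by have := XT; rewrite -(ltr_pM2r ev_gt0); lra.
  have rT : 0 < rho / mu ^+ T by rewrite divr_gt0.
  split; last first.
    apply: le_lt_trans small_e.
    have : 1 * (rho / mu ^+ T) <= mu * (rho / mu ^+ T) by rewrite ler_wpM2r //; lra.
    lra.
  rewrite -[X in _ < X]root4.
  apply: (@lt_trans _ _ ((2 * (mu * (rho / mu ^+ T))) ^+ 4)).
    by rewrite [X in _ < X]exprMn ltr_pM2r ?exprn_gt0 ?(mulr_gt0 mu0) //; lra.
  by rewrite ltr_pXn2r ?nnegrE ?powR_ge0 // mulr_ge0 // mulr_ge0 ?(ltW mu0) ?(ltW rT).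
have [f [_ up lo]] := partial_embedding_exists T rho0 rho_gt.
exists f; split.
  move=> i x y; have [->|xy] := eqVneq x y.
    rewrite subrr normr0; have -> : 0 `^ (4 / 3) = 0 :> R by apply: powR0; apply/eqP; lra.
    by rewrite mulr_ge0.
  set e := d x y `^ 4^-1.
  have e0 : 0 <= e by exact: powR_ge0.
  have eE : e ^+ 4 = d x y by exact: root4.
  have rT : 0 < (rho / mu ^+ T) ^+ 3 by rewrite exprn_gt0 // divr_gt0 ?exprn_gt0.
  have := up i x y e eE (HT x y xy).2 => h.
  have h8 : `|f i x - f i y| <= (2 * e) ^+ 3 by rewrite exprMn; lra.
  have := mono _ _ (normr_ge0 _) h8.
  by rewrite pow43 ?mulr_ge0 // exprMn eE => /le_trans; apply; lra.
move=> x y xy.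
have [i [s [s0 ds fs]]] := lo x y (ltW (HT x y xy).1).
exists i.
have h : (s / mu) ^+ 3 <= `|f i x - f i y|.
  apply: le_trans fs.
  have : 0 < (rho / mu ^+ T) ^+ 3 by rewrite exprn_gt0 // divr_gt0 ?exprn_gt0.
  suff : (s / mu) ^+ 3 <= s ^+ 3 / (8 * M) by lra.
  rewrite expr_div_n ler_pM2l ?exprn_gt0 // lef_pV2 ?posrE ?exprn_gt0 //; lra.
have sm0 : 0 <= s / mu by rewrite divr_ge0 ?ltW.
have := mono _ _ (exprn_ge0 _ sm0) h; rewrite pow43 // => H.
apply: le_trans ds _.
have -> : 8 * mu ^+ 4 * s ^+ 4 = 8 * mu ^+ 8 * (s / mu) ^+ 4 by field; apply/eqP; lra.
by rewrite ler_wpM2l ?mulr_ge0 ?exprn_ge0 ?(ltW mu0).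
Qed.

End Multiscale.

(** * Choice of the parameters *)

Lemma doubling_ok_le (R : realType) (k : nat) (d : 'I_k -> 'I_k -> R) (K K' : nat) :
  (K <= K')%N -> doubling_ok d K -> doubling_ok d K'.
Proof.
move=> KK' dK i r r0; have [C [CK HC]] := dK i r r0.
by exists C; split=> //; exact: leq_trans KK'.
Qed.

(** The least [a] with [512 * kap <= 4 ^ a]; then [2 ^ a], the future [mu], is of order the square
    root of [kap]. The last clause, the future [32 * m <= mu ^ 3], reduces to
    [32 * (3 * kap + a) <= 4 ^ a] and follows from [a <= 6 * kap]. *)
Lemma scale_exponent (kap : nat) : (0 < kap)%N -> exists a : nat,
  [/\ (3 <= a)%N, (4 ^ a <= 2048 * kap)%N & (32 * (2 ^ a * (3 * kap + a)) <= 2 ^ (3 * a))%N].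
Proof.
move=> kap0.
have kap2 := ltn_expl kap (isT : 1 < 2)%N.
have ex : exists a, (512 * kap <= 4 ^ a)%N.
  exists (kap + 5)%N; rewrite expnD mulnC leq_mul //.
  by apply: leq_trans (ltnW kap2) _; rewrite leq_exp2r.
have [a aP amin] := ex_minnP ex.
have a5 : (4 < a)%N.
  rewrite ltnNge; apply/negP => a4.
  have : (4 ^ a <= 4 ^ 4)%N by rewrite leq_exp2l.
  by have -> : (4 ^ 4 = 256)%N by []; lia.
have alt : (4 ^ a.-1 < 512 * kap)%N by rewrite ltnNge; apply/negP => /amin; lia.
have a4 : (4 ^ a = 4 * 4 ^ a.-1)%N by rewrite -expnS prednK //; lia.
have a6 : (a <= 6 * kap)%N.
  have : (2 ^ (2 * a.-1) < 2 ^ (9 + kap))%N.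
    rewrite expnM expnD; apply: leq_trans alt _.
    by rewrite leq_mul // ltnW.
  by rewrite ltn_exp2l //; lia.
exists a; split; [lia|lia|].
have -> : (2 ^ (3 * a) = 2 ^ a * 4 ^ a)%N.
  by rewrite (_ : 4 = 2 ^ 2)%N // -expnM -expnD; congr (_ ^ _)%N; lia.
rewrite mulnCA leq_mul2l; apply/orP; right; lia.
Qed.

(** For [x = 1 / h], Bernoulli gives [2 <= (1 + x) ^+ h], while [(1 - x) * (1 + x) <= 1]. *)
Lemma expr_onem_half (R : realFieldType) (h : nat) : (0 < h)%N ->
  (1 - h%:R^-1) ^+ h <= 2^-1 :> R.
Proof.
move=> h0; set x : R := h%:R^-1.
have x0 : 0 < x by rewrite invr_gt0 ltr0n.
have x1 : x <= 1 by rewrite invf_le1 ?ltr0n // (ler_nat _ 1).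
have bern n : 1 + n%:R * x <= (1 + x) ^+ n.
  elim: n => [|n IH]; first by rewrite mul0r addr0 expr0.
  have := ler_wpM2l (_ : 0 <= 1 + x) IH; rewrite exprS -natr1.
  have : 0 <= n%:R * (x * x) by rewrite mulr_ge0 ?mulr_ge0 ?(ltW x0).
  by move=> ? /(_ ltac:(lra)); lra.
have h2 : 2 <= (1 + x) ^+ h.
  by have := bern h; rewrite /x mulfV ?pnatr_eq0 -?lt0n //; lra.
have h1 : (1 - x) ^+ h * (1 + x) ^+ h <= 1.
  rewrite -exprMn; apply: exprn_ile1; first by rewrite mulr_ge0; lra.
  by have : 0 < x * x by [rewrite mulr_gt0]; lra.
have h0' : 0 <= (1 - x) ^+ h by apply: exprn_ge0; lra.
by have := ler_wpM2l h0' h2; lra.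
Qed.

(** With [mu = 2 ^ a] and [q = 1 - 1 / mu], this [m] makes the truncation error at most [1 / mu]; a
    coordinate then fails with probability at most [2 / mu], and [32 * kap] coordinates suffice for
    the local lemma. *)
Lemma assouad (R : realType) (k : nat) (d : 'I_k -> 'I_k -> R) (kap : nat) :
  (0 < kap)%N -> is_metric d -> doubling_ok d (2 ^ kap) ->
  exists (f : 'I_(32 * kap) -> 'I_k -> R) (c : R),
    [/\ 0 < c, c <= 8 * (2048 * kap%:R) ^+ 4,
        forall i x y, `|f i x - f i y| `^ (4 / 3) <= 16 * d x y &
        forall x y, x != y -> exists i, d x y <= c * `|f i x - f i y| `^ (4 / 3)].
Proof.
move=> kap0 d_metric d_doubling.
have [a [a3 a_up a_m]] := scale_exponent kap0.
set m := (2 ^ a * (3 * kap + a))%N in a_m.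
have m0 : (0 < m)%N by rewrite muln_gt0 expn_gt0 /=; lia.
pose h := (2 ^ a)%N.
have h0 : (0 < h)%N by rewrite expn_gt0.
pose mu : R := h%:R.
pose q : R := 1 - h%:R^-1.
have h8 : (8 <= h)%N by rewrite (_ : 8 = 2 ^ 3)%N // leq_exp2l.
have hi0 : 0 < h%:R^-1 :> R by rewrite invr_gt0 ltr0n.
have hi1 : h%:R^-1 <= 1 :> R by rewrite invf_le1 ?ltr0n // (ler_nat _ 1).
have q0 : 0 <= q by rewrite /q; lra.
have q1 : q <= 1 by rewrite /q; lra.
have qm : ((2 ^ kap) ^ 3)%:R * q ^+ m <= h%:R^-1.
  have : q ^+ m <= (2 ^+ (3 * kap + a))^-1.
    rewrite exprM -exprVn lerXn2r ?nnegrE ?exprn_ge0 // ?invr_ge0 //.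
    exact: expr_onem_half.
  move=> /(ler_wpM2l (ler0n R ((2 ^ kap) ^ 3))) /le_trans; apply.
  rewrite -expnM (mulnC kap) exprD invfM natrX mulVKf ?expf_neq0 ?pnatr_eq0 //.
  by rewrite /h natrX.
have [||||f [fup flo]] := @snowflake_embedding R k (32 * kap) d mu m%:R d_metric.
- by rewrite /mu (ler_nat _ 2); lia.
- by rewrite ltr0n.
- by rewrite /mu -natrX -natrM ler_nat /h -expnM (mulnC a 3); exact: a_m.
- move=> r H r0 H_lip.
  (* The exponent [7 * a + 4] comes from [8 * mu ^+ 4 + 6 <= 2 ^ (4 * a + 4)] and
     [32 * m <= 2 ^ (3 * a)]. *)
  have := @separating_bumps R k d (2 ^ kap) d_metric d_doubling (32 * kap) m (7 * a + 4) q
    (8 * mu ^+ 4) r H.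
  rewrite -[4 * m%:R]natrM; apply=> //.
  + by rewrite expn_gt0.
  + by rewrite muln_gt0.
  + by rewrite mulr_ge0 ?exprn_ge0.
  + rewrite /mu -!natrX -!natrM -!natrD -natrM ler_nat.
    apply: (@leq_trans (2 ^ (4 * a + 4) * 2 ^ (3 * a))%N); last first.
      by rewrite -expnD leq_exp2l //; lia.
    rewrite leq_mul // expnD /h -expnM mulnC (mulnC a).
    have : (1 <= 2 ^ (4 * a))%N by rewrite expn_gt0.
    lia.
  + set p := (X in X ^+ _).
    have p2 : p <= (2 ^+ a.-1)^-1.
      have -> : (2 ^+ a.-1)^-1 = h%:R^-1 + h%:R^-1 :> R.
        have e : h%:R = 2 * 2 ^+ a.-1 :> R by rewrite /h natrX -exprS prednK //; lia.
        by rewrite e; field; rewrite expf_neq0 ?pnatr_eq0.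
      by rewrite /p /q; lra.
    have p0 : 0 <= p by rewrite /p /q addr_ge0 ?mulr_ge0 ?exprn_ge0 //; lra.
    (* The exponent [14 * a * kap + 20 * kap] is at most [(a - 1) * 32 * kap] because [a >= 3]. *)
    apply: (@le_trans _ _ ((2 ^+ (a.-1 * (32 * kap)))^-1 * (2 ^ (14 * a * kap + 20 * kap))%:R)).
      rewrite -mulrA -natrM; apply: ler_pM; rewrite ?exprn_ge0 ?ler0n //.
        by rewrite (exprM 2 a.-1) -exprVn lerXn2r ?nnegrE ?invr_ge0 ?exprn_ge0.
      rewrite ler_nat -!expnM -!expnD.
      apply: (@leq_trans (2 ^ (kap * (7 * a + 4) + kap * (7 * a + 4)) * (2 ^ (8 + kap * 3 + kap)))%N).
        rewrite leq_mul2l; apply/orP; right.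
        rewrite (_ : 4 * (2 * 2 ^ (kap * 3) * (32 * kap)) = 256 * 2 ^ (kap * 3) * kap)%N; last by ring.
        rewrite !expnD leq_mul // ltnW //; exact: ltn_expl.
      by rewrite -expnD leq_exp2l //; lia.
    rewrite mulrC ler_pdivrMr ?exprn_gt0 // mul1r natrX ler_weXn2l //.
      by rewrite (ler_nat _ 1).
    by have : (3 * kap <= a * kap)%N; [rewrite leq_mul2r a3 orbT|lia].
exists f, (8 * mu ^+ 8); split=> //.
- by rewrite mulr_gt0 ?exprn_gt0 ?ltr0n.
- rewrite ler_wpM2l // (_ : mu ^+ 8 = (mu ^+ 2) ^+ 4); last by rewrite -exprM.
  rewrite lerXn2r ?nnegrE ?exprn_ge0 ?mulr_ge0 ?ler0n //.
  by rewrite /mu -natrX -natrM ler_nat /h -expnM mulnC expnM.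
Qed.

(** * Dilworth's theorem *)

Section Dilworth.
Variables (T : finType) (leT : rel T).
Hypotheses (leT_refl : reflexive leT) (leT_anti : antisymmetric leT) (leT_trans : transitive leT).

Let antichain (A : {set T}) := forall x y, x \in A -> y \in A -> leT x y -> x = y.

Lemma maximal_exists (P : pred T) x0 : P x0 ->
  exists2 x, P x & forall y, P y -> leT x y -> y = x.
Proof.
move=> Px0; pose h x := #|[set z | leT z x]|.
case: (arg_maxnP h Px0) => x Px xmax; exists x => // y Py xy.
apply: leT_anti; rewrite xy andbT.
have sub : [set z | leT z x] \subset [set z | leT z y].
  by apply/subsetP => z; rewrite !inE => /leT_trans; apply.
have /eqP : [set z | leT z x] == [set z | leT z y] by rewrite eqEcard sub; exact: xmax.
by move=> /setP/(_ y); rewrite !inE leT_refl.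
Qed.

(* Galvin's proof: remove a maximal element, and in a minimal chain colouring
   of the rest take the top elements [x i] belonging to a largest antichain. *)
Lemma dilworth (S : {set T}) : exists (A : {set T}) (c : T -> nat),
  [/\ A \subset S, antichain A,
      forall x, x \in S -> (c x < #|A|)%N &
      forall x y, x \in S -> y \in S -> c x = c y -> leT x y || leT y x].
Proof.
have [n] := ubnP #|S|; elim: n S => // n IH S; rewrite ltnS => Sn.
have [->|[s0 s0S]] := set_0Vmem S.
  by exists set0, (fun=> 0%N); split=> // [x y|x|x y]; rewrite inE.
have [a aS amax] := maximal_exists (P := fun z => z \in S) s0S.
have S'n : (#|S :\ a| < n)%N by have := cardsD1 a S; rewrite aS; lia.
have [A' [c' [A'S' antiA' c'k c'chain]]] := IH _ S'n.
set S' := S :\ a in A'S' c'k c'chain; set k := #|A'| in c'k.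
have c'inj (B : {set T}) : B \subset S' -> antichain B -> {in B &, injective c'}.
  move=> BS' antiB x y xB yB cxy.
  have /orP[/antiB -> //|/antiB-> //] := c'chain x y (subsetP BS' x xB) (subsetP BS' y yB) cxy.
(* The colouring is injective on antichains, so [k] bounds their size, and one of size [k] meets
   every colour. *)
have c'card (B : {set T}) : B \subset S' -> antichain B ->
    (#|B| <= k)%N /\ (#|B| = k -> forall i : 'I_k, exists2 y, y \in B & c' y = i).
  move=> BS' antiB.
  have sizeB : size [seq c' x | x <- enum B] = #|B| by rewrite size_map -cardE.
  have uB : uniq [seq c' x | x <- enum B].
    rewrite map_inj_in_uniq ?enum_uniq // => x y; rewrite !mem_enum; exact: c'inj.
  have subB : {subset [seq c' x | x <- enum B] <= iota 0 k}.
    move=> i /mapP[x]; rewrite mem_enum => xB ->; rewrite mem_iota /= add0n.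
    by apply: c'k; exact: (subsetP BS').
  split; first by have := uniq_leq_size uB subB; rewrite sizeB size_iota.
  move=> Bk i; have [|_ eqB] := uniq_min_size uB subB; first by rewrite sizeB Bk size_iota.
  have : (i : nat) \in [seq c' x | x <- enum B].
    by rewrite eqB mem_iota ltn_ord.
  by case/mapP => y; rewrite mem_enum => yB ->; exists y.
pose good z := [exists B : {set T}, [&& B \subset S', #|B| == k, z \in B &
  [forall x in B, forall y in B, leT x y ==> (x == y)]]].
have goodP z : good z -> exists B : {set T}, [/\ B \subset S', #|B| = k, z \in B & antichain B].
  case/existsP => B /and4P[BS' /eqP Bk zB /forall_inP antiB]; exists B; split=> // x y xB yB xy.
  by have /forall_inP/(_ y yB)/implyP/(_ xy)/eqP := antiB x xB.
have goodI (B : {set T}) z : B \subset S' -> #|B| = k -> z \in B -> antichain B -> good z.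
  move=> BS' Bk zB antiB; apply/existsP; exists B; rewrite BS' Bk eqxx zB /=.
  by apply/forall_inP => x xB; apply/forall_inP => y yB; apply/implyP => /(antiB x y xB yB) ->.
have goodS' z : good z -> z \in S' by case/goodP => B [/subsetP BS' _ /BS'].
have [x xP] : exists x : 'I_k -> T, forall i, [/\ good (x i), c' (x i) = i &
    forall z, good z -> c' z = i -> leT z (x i)].
  apply: (fin_all_exists (P := fun i xi => [/\ good xi, c' xi = (i : 'I_k) &
    forall z, good z -> c' z = i -> leT z xi])) => i.
  have [y yA' cy] := (c'card A' A'S' antiA').2 erefl i.
  have Py : good y && (c' y == i) by rewrite (goodI A') //= cy.
  have [xi /andP[gxi /eqP cxi] ximax] := maximal_exists (P := fun z => good z && (c' z == i)) Py.
  exists xi; split=> // z gz cz.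
  have /orP[//|xz] := c'chain z xi (goodS' _ gz) (goodS' _ gxi) (etrans cz (esym cxi)).
  by rewrite (ximax z) ?leT_refl // gz cz /=.
have xcol i : c' (x i) = i by have [] := xP i.
have xgood i : good (x i) by have [] := xP i.
have xinj : injective x by move=> i j ij; apply: val_inj; rewrite /= -!xcol ij.
pose A0 := [set x i | i : 'I_k].
have A0k : #|A0| = k by rewrite card_imset // card_ord.
(* An antichain of size [k] through [x j] has an element of colour [i]; it lies below [x i], so
   [x i] below [x j] would make it comparable to [x j]. *)
have xanti i j : leT (x i) (x j) -> i = j.
  move=> xij; have [B [BS' Bk xjB antiB]] := goodP _ (xgood j).
  have [y yB cy] := (c'card B BS' antiB).2 Bk i.
  have [_ _ /(_ y (goodI _ _ BS' Bk yB antiB) cy) yxi] := xP i.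
  have yxj := antiB y (x j) yB xjB (leT_trans yxi xij).
  by apply: val_inj; rewrite /= -cy yxj xcol.
have A0anti : antichain A0.
  by move=> y z /imsetP[i _ ->] /imsetP[j _ ->] /xanti ->.
have A0S' : A0 \subset S' by apply/subsetP => y /imsetP[i _ ->]; exact: goodS'.
have S'S : S' \subset S by exact: subD1set.
(* If [a] is above no [x i], it extends the antichain and receives a new colour; otherwise the chain
   [C0] through [a] is split off. *)
have [/existsP[i0 xa]|/existsPn xa] := boolP [exists i, leT (x i) a]; last first.
  exists (a |: A0), (fun z => if z == a then k else c' z).
  have aA0 : a \notin A0 by apply/negP => /(subsetP A0S'); rewrite !inE eqxx.
  split.
  - by rewrite subUset sub1set aS (subset_trans A0S').
  - move=> y z; rewrite !in_setU1 => /predU1P[->|yA] /predU1P[->|zA] // yz.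
    + by rewrite (amax z) // (subsetP S'S) // (subsetP A0S').
    + by case/imsetP: yA yz => i _ -> H; move: (xa i); rewrite H.
    + exact: A0anti.
  - move=> z zS; rewrite cardsU1 aA0 A0k add1n; case: eqP => // za.
    by rewrite ltnS ltnW // c'k // !inE zS andbT; apply/eqP.
  - move=> y z yS zS; case: eqP => [->|ya]; case: eqP => [->|za] //.
    + by rewrite leT_refl.
    + by move=> e; have := c'k z; rewrite -e ltnn !inE zS andbT => /(_ (introN eqP za)).
    + by move=> e; have := c'k y; rewrite e ltnn !inE yS andbT => /(_ (introN eqP ya)).
    + by apply: c'chain; rewrite !inE ?yS ?zS andbT; exact/eqP.
pose C0 := a |: [set z in S' | (c' z == i0) && leT z (x i0)].
have S''n : (#|S :\: C0| < n)%N.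
  apply: leq_ltn_trans S'n; apply: subset_leq_card; apply: setDS.
  by rewrite sub1set !inE eqxx.
have [A2 [c2 [A2S antiA2 c2k c2chain]]] := IH _ S''n.
have S2S' : S :\: C0 \subset S'.
  apply/subsetP => z; rewrite in_setD in_setU1 negb_or => /andP[/andP[za _] zS].
  by rewrite !inE za.
have A2S' : A2 \subset S' by exact: subset_trans S2S'.
(* An antichain of size [k] avoiding [C0] would have an element of colour [i0], which lies below
   [x i0] and hence in [C0]. *)
have A2k : (#|A2| < k)%N.
  have [A2le A2eq] := c'card A2 A2S' antiA2.
  rewrite ltn_neqAle A2le andbT; apply/eqP => e.
  have [y yA2 cy] := A2eq e i0.
  have [_ _ /(_ y (goodI _ _ A2S' e yA2 antiA2) cy) yx] := xP i0.
  have := subsetP A2S y yA2; rewrite in_setD in_setU1 negb_or => /andP[/andP[_ /negP]].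
  by case; rewrite inE (subsetP A2S' y yA2) cy eqxx.
have k0 : (0 < k)%N := leq_ltn_trans (leq0n _) A2k.
exists A0, (fun z => if z \in C0 then k.-1 else c2 z); split=> //.
- exact: subset_trans S'S.
- move=> z zS; rewrite A0k; case: ifP => zC; first by rewrite prednK.
  by apply: ltn_trans A2k; apply: c2k; rewrite in_setD zC.
- have C0top z : z \in C0 -> leT z a.
    rewrite in_setU1 => /predU1P[->//|]; rewrite inE => /and3P[_ _ zx].
    exact: leT_trans xa.
  move=> y z yS zS; case: ifP => yC; case: ifP => zC.
  + move=> _; move: (yC) (zC); rewrite !in_setU1.
    move=> /predU1P[->|yC'] /predU1P[->|zC']; rewrite ?leT_refl ?C0top ?orbT //.
    move: yC' zC'; rewrite in_set => /and3P[yS' /eqP cy _].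
    rewrite in_set => /and3P[zS' /eqP cz _].
    by apply: c'chain; rewrite // cy cz.
  + by move=> e; have := c2k z; rewrite -e in_setD zC zS prednK // => /(_ isT); rewrite leqNgt A2k.
  + by move=> e; have := c2k y; rewrite e in_setD yC yS prednK // => /(_ isT); rewrite leqNgt A2k.
  + by apply: c2chain; rewrite in_setD ?yC ?zC.
Qed.

End Dilworth.

(** If [u] is not below [v], the chain of [u] detects it: its elements below [v] are below [u], as
    one above [u] would put [u] below [v], and [u] itself is counted only for [u]. *)
Lemma width_order_embedding (k W : nat) (le : 'I_k -> 'I_k -> Prop) :
  is_partial_order le -> width le W ->
  exists g : 'I_W -> 'I_k -> nat,
    forall u v, le u v <-> forall t, (g t u <= g t v)%N.
Proof.
move=> [le_refl le_anti le_trans] [_ leW].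
pose leb : rel 'I_k := fun u v => `[< le u v >].
have leb_refl : reflexive leb by move=> u; apply/asboolP.
have leb_anti : antisymmetric leb.
  by move=> u v /andP[/asboolP uv /asboolP vu]; exact: le_anti.
have leb_trans : transitive leb.
  by move=> v u z /asboolP uv /asboolP vz; apply/asboolP; exact: le_trans vz.
have [A [c [_ antiA cA chain]]] := dilworth leb_refl leb_anti leb_trans [set: 'I_k].
have AW : (#|A| <= W)%N.
  apply: leW => i j iA jA ij; split=> /asboolP lij; case/eqP: ij.
    exact: antiA.
  by apply/esym; exact: antiA.
exists (fun (t : 'I_W) u => #|[set z | (c z == t :> nat) && leb z u]|) => u v; split.
  move=> /asboolP uv t; apply: subset_leq_card; apply/subsetP => z; rewrite !inE.
  by case/andP => -> zu; exact: leb_trans uv.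
have cW : (c u < W)%N by apply: leq_trans AW; apply: cA; rewrite inE.
move=> /(_ (Ordinal cW)) /= card_le; apply/asboolP/negPn/negP => uv.
move: card_le; rewrite leqNgt => /negP; apply; apply: proper_card.
apply/properP; split.
  apply/subsetP => z; rewrite !inE => /andP[/eqP cz zv]; rewrite cz eqxx /=.
  have /orP[uz|//] := chain u z (in_setT _) (in_setT _) (esym cz).
  by case/negP: uv; exact: leb_trans zv.
by exists u; rewrite !inE eqxx /= ?leb_refl.
Qed.

(** * Exact embedding with a large exponent *)

(** Banach's fixed point theorem in the supremum norm, by iteration from 0. *)
Lemma half_contraction_fixpoint (R : realType) (I : finType) (T : (I -> R) -> I -> R) :
  (forall a b e, (forall i, `|a i - b i| <= e) -> forall i, `|T a i - T b i| <= e / 2) ->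
  exists a, forall i, T a i = a i.
Proof.
move=> T_half.
pose a n := iter n T (fun=> 0).
pose C := \sum_i `|T (fun=> 0) i|.
have C0 : 0 <= C by apply: sumr_ge0.
pose g n : R := (2 ^+ n)^-1.
have g0 n : 0 < g n by rewrite invr_gt0 exprn_gt0.
have gS n : g n = 2 * g n.+1 by rewrite /g exprS; field; rewrite expf_neq0 ?pnatr_eq0.
have step n i : `|a n.+1 i - a n i| <= C * g n.
  elim: n i => [|n IH] i.
    by rewrite /= subr0 /g expr0 invr1 mulr1 /C (bigD1 i) //= lerDl sumr_ge0.
  by have := T_half _ _ _ IH i; rewrite gS; rewrite (_ : C * (2 * g n.+1) / 2 = C * g n.+1) //; field.
(* [a n i - 2 * C * g n] is nondecreasing in [n], and its supremum is the limit *)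
have low i n m : (n <= m)%N -> a n i - 2 * C * g n <= a m i - 2 * C * g m.
  move=> /subnK <-; elim: (m - n)%N => [|j IH]; first by rewrite add0n.
  apply: le_trans IH _; rewrite addSn.
  by have := step (j + n)%N i; rewrite ler_norml gS; lra.
have up i n m : (n <= m)%N -> a m i + 2 * C * g m <= a n i + 2 * C * g n.
  move=> /subnK <-; elim: (m - n)%N => [|j IH]; first by rewrite add0n.
  apply: le_trans IH; rewrite addSn.
  by have := step (j + n)%N i; rewrite ler_norml gS; lra.
have Cg n : 0 <= 2 * C * g n by rewrite mulr_ge0 ?(ltW (g0 n)) // mulr_ge0.
have cross i n m : a n i - 2 * C * g n <= a m i + 2 * C * g m.
  apply: (le_trans (low i _ _ (leq_maxl n m))).
  apply: le_trans (up i _ _ (leq_maxr n m)).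
  by have := Cg (maxn n m); lra.
pose l i := sup (range (fun n => a n i - 2 * C * g n)).
have l_close i n : `|a n i - l i| <= 2 * C * g n.
  have ub m : ubound (range (fun n => a n i - 2 * C * g n)) (a m i + 2 * C * g m).
    by move=> _ [n' _ <-].
  have ne : nonempty (range (fun n => a n i - 2 * C * g n)) by exists (a 0%N i - 2 * C * g 0%N), 0%N.
  have h1 : a n i - 2 * C * g n <= l i.
    by apply: ub_le_sup; [exists (a 0%N i + 2 * C * g 0%N)|exists n].
  have h2 : l i <= a n i + 2 * C * g n by apply: ge_sup.
  by rewrite ler_norml; lra.
exists l => i; apply/eqP; rewrite -subr_eq0 -normr_le0 leNgt; apply/negP => pos.
have small n : `|T l i - l i| <= 2 * C * g n.
  have := T_half (a n) l _ (l_close^~ n) i; have := l_close i n.+1.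
  have := ler_normB (a n.+1 i - l i) (a n.+1 i - T l i); rewrite /= [X in `|X|](_ : _ = T l i - l i); last by ring.
  by rewrite (gS n); lra.
have D0 : 0 <= 2 * C / `|T l i - l i| by rewrite !mulr_ge0 ?invr_ge0.
have := archi_boundP D0; set n := Num.bound _; rewrite ltr_pdivrMr // => hn.
have := small n; rewrite /g ler_pdivlMr ?exprn_gt0 // mulrC => hs.
have : n%:R * `|T l i - l i| <= 2 ^+ n * `|T l i - l i|.
  by rewrite ler_wpM2r // -natrX ler_nat ltnW // ltn_expl.
move: hn hs; move: (2 ^+ n * _) (n%:R * _) => A B; lra.
Qed.

(** The cofactor of [x - y] is a sum of [n] terms, each at least 1. Read backwards, the [n]-th root
    is Lipschitz with constant [1 / n] on numbers at least 1. *)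
Lemma expr_diff_ge (R : realType) (n : nat) (x y : R) :
  1 <= x -> 1 <= y -> n%:R * `|x - y| <= `|x ^+ n - y ^+ n|.
Proof.
move=> x1 y1; rewrite subrXX normrM mulrC ler_wpM2l //.
apply: le_trans (ler_norm _); rewrite -[X in X <= _]mulr1 mulr_natl.
have -> : 1 *+ n = \sum_(i < n) (1 : R) by rewrite sumr_const card_ord.
by apply: ler_sum => i _; rewrite -[1]mulr1 ler_pM // ?exprn_ege1.
Qed.

Lemma expr_diff_le (R : realType) (n : nat) (x y M : R) :
  0 <= x <= M -> 0 <= y <= M -> `|x ^+ n.+1 - y ^+ n.+1| <= n.+1%:R * M ^+ n * `|x - y|.
Proof.
move=> /andP[x0 xM] /andP[y0 yM]; rewrite subrXX normrM mulrC ler_wpM2r //.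
rewrite ger0_norm; last by apply: sumr_ge0 => i _; rewrite mulr_ge0 ?exprn_ge0.
rewrite mulr_natl.
have -> : M ^+ n *+ n.+1 = \sum_(i < n.+1) M ^+ n by rewrite sumr_const card_ord.
apply: ler_sum => i _; rewrite -[in X in _ <= X](@subnK i n) -1?ltnS // exprD.
by rewrite ler_pM ?exprn_ge0 // lerXn2r ?nnegrE // (le_trans _ xM).
Qed.

Lemma clamp_lipschitz (R : realType) (A B s t : R) : A <= B ->
  `|Num.max A (Num.min s B) - Num.max A (Num.min t B)| <= `|s - t|.
Proof.
have := ler_norm (s - t); have := ler_norm (t - s); rewrite distrC.
move: `|s - t| => c h1 h2 AB; rewrite ler_norml.
by case: (leP s B); case: (leP t B); case: (leP A s); case: (leP A t); case: (leP A B); lra.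
Qed.

(* For a large exponent [p], the point with [p]-th power distances to the
   others given by [a] is almost decoupled from the remaining coordinates, so
   the equations for [a] form a contraction. *)
Lemma exact_power_embedding (R : realType) (k : nat) (d : 'I_k -> 'I_k -> R) :
  is_metric d ->
  exists (p : nat) (w : R) (f : 'I_k -> 'I_k -> R),
    [/\ (0 < p)%N, 0 < w &
        forall x y, d x y = w * \sum_i `|f i x - f i y| ^+ p].
Proof.
move=> [d0 dE dC _].
(* Division by [w] brings every non-zero distance to at least 4. *)
pose w := (4 * (1 + \sum_x \sum_y (d x y)^-1))^-1.
have sum0 : 0 <= \sum_x \sum_y (d x y)^-1.
  by apply: sumr_ge0 => x _; apply: sumr_ge0 => y _; rewrite invr_ge0.
have w0 : 0 < w by rewrite invr_gt0; lra.
pose e x y := d x y / w.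
have e_ge4 x y : x != y -> 4 <= e x y.
  move=> xy; have dxy : 0 < d x y.
    by rewrite lt_neqAle d0 andbT eq_sym; apply/eqP => /dE /eqP; exact/negP.
  have : (d x y)^-1 <= \sum_x \sum_y (d x y)^-1.
    rewrite (bigD1 x) //= (bigD1 y) //= -addrA lerDl.
    rewrite addr_ge0 ?sumr_ge0 // => z _; first by rewrite invr_ge0.
    by apply: sumr_ge0 => ? _; rewrite invr_ge0.
  move=> /(ler_wpM2l (d0 x y)); rewrite divff ?gt_eqF // /e /w invrK; lra.
have e0 x y : 0 <= e x y by rewrite divr_ge0 // ltW.
pose B := 1 + \sum_x \sum_y e x y.
have e_leB x y : e x y <= B.
  have : e x y <= \sum_x \sum_y e x y.
    rewrite (bigD1 x) //= (bigD1 y) //= -addrA lerDl.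
    by rewrite addr_ge0 ?sumr_ge0 // => z _; rewrite ?sumr_ge0.
  by rewrite /B; lra.
have B1 : 1 <= B by rewrite lerDl; apply: sumr_ge0 => x _; apply: sumr_ge0.
(* For [p >= 4 * k * B], the [p]-th roots of numbers between 1 and [B] differ by at most
   [M = B / p], with [4 * k * M <= 1]. Having [p >= 2] gives [M ^+ p.-1 <= M]. *)
have [n Bn] : exists n : nat, 4 * k%:R * B <= n.+2%:R.
  have h : 0 <= 4 * k%:R * B by rewrite mulr_ge0 ?mulr_ge0 ?ler0n //; lra.
  exists (Num.bound (4 * k%:R * B)); apply: le_trans (ltW (archi_boundP h)) _.
  by rewrite ler_nat ltnW.
set p := n.+2 in Bn.
have p0 : 0 < p%:R :> R by rewrite ltr0n.
pose M := B / p%:R.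
have M0 : 0 <= M by rewrite divr_ge0 ?ltW //; lra.
have kM : 4 * k%:R * M <= 1 by rewrite /M mulrA ler_pdivrMr // mul1r.
have [k1|k1] := leqP k 0.
  by exists 1%N, 1, (fun _ _ => 0); split=> // x; have := ltn_ord x; rewrite ltnNge (leq_trans k1).
have k1R : 1 <= k%:R :> R by rewrite (ler_nat _ 1).
have M1 : 4 * M <= 1.
  by apply: le_trans kM; rewrite -mulrA ler_wpM2l // ler_peMl.
(* Clamping makes the equations meaningful and Lipschitz for every [a]; off the diagonal the fixed
   point lies between 1 and [B], where clamping does nothing. *)
pose cl (t : R) := Num.max 1 (Num.min t B).
have cl1 t : 1 <= cl t by rewrite le_max lexx.
have clB t : cl t <= B by rewrite ge_max B1 ge_min lexx orbT.
have cl_id t : 1 <= t <= B -> cl t = t by case/andP=> t1 tB; rewrite /cl min_l // max_r.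
have cl_lip s t : `|cl s - cl t| <= `|s - t| by exact: clamp_lipschitz.
pose rt (t : R) := t `^ p%:R^-1.
have rtK t : 1 <= t -> rt t ^+ p = t.
  move=> t1; rewrite -powR_mulrn ?powR_ge0 // -powRrM mulVf ?powRr1 ?gt_eqF //; lra.
have rt1 t : 1 <= t -> 1 <= rt t.
  move=> t1; rewrite leNgt; apply/negP => lt1.
  by have := exprn_ilt1 n.+2 (powR_ge0 t _) lt1; rewrite rtK //=; lra.
have rt_lip s t : 1 <= s -> 1 <= t -> `|rt s - rt t| <= `|s - t| / p%:R.
  move=> s1 t1; rewrite ler_pdivlMr // mulrC.
  by have := expr_diff_ge p (rt1 s s1) (rt1 t t1); rewrite !rtK.
pose X (a : 'I_k * 'I_k -> R) l i j := `|rt (cl (a (l, i))) - rt (cl (a (l, j)))|.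
have XM a l i j : 0 <= X a l i j <= M.
  rewrite normr_ge0 /=; apply: le_trans (rt_lip _ _ (cl1 _) (cl1 _)) _.
  rewrite ler_pM2r ?invr_gt0 // ler_norml.
  by have := cl1 (a (l, i)); have := clB (a (l, i)); have := cl1 (a (l, j)); have := clB (a (l, j)); lra.
have Xp a l i j : X a l i j ^+ p <= M.
  have /andP[X0 XM'] := XM a l i j.
  apply: (@le_trans _ _ (M ^+ p)); first by rewrite lerXn2r ?nnegrE.
  by rewrite ler_iXnr //; lra.
(* Coordinates [i] and [j] should contribute [a (i, j)] and [a (j, i)] to the pair; by symmetry each
   is half of what the other coordinates leave. *)
pose T a (ij : 'I_k * 'I_k) :=
  (e ij.1 ij.2 - \sum_(l | (l != ij.1) && (l != ij.2)) X a l ij.1 ij.2 ^+ p) / 2.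
have card_le (P : pred 'I_k) (c : R) : 0 <= c -> \sum_(l | P l) c <= k%:R * c.
  move=> c0; rewrite sumr_const -[_ *+ #|_|]mulr_natl ler_wpM2r // ler_nat.
  by rewrite -[X in (_ <= X)%N]card_ord max_card.
have [a aT] : exists a, forall ij, T a ij = a ij.
  apply: half_contraction_fixpoint => a b ep ab [i j].
  have ep0 : 0 <= ep by apply: le_trans (ab (i, j)).
  rewrite /T /= -mulrBl normrM [`|2^-1|]gtr0_norm ?invr_gt0 // ler_pM2r ?invr_gt0 //.
  rewrite [X in `|X|](_ : _ = \sum_(l | (l != i) && (l != j))
    (X a l i j ^+ p - X b l i j ^+ p) * -1); last by rewrite -mulr_suml sumrB; ring.
  apply: le_trans (ler_norm_sum _ _ _) _.
  apply: (@le_trans _ _ (\sum_(l | (l != i) && (l != j)) 2 * ep * M)).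
    apply: ler_sum => l _.
    rewrite mulrN1 normrN; apply: le_trans (expr_diff_le n.+1 (XM a l i j) (XM b l i j)) _.
    have XX : `|X a l i j - X b l i j| <= 2 * ep / p%:R.
      apply: le_trans (ler_dist_dist _ _) _.
      rewrite (_ : _ - _ = (rt (cl (a (l, i))) - rt (cl (b (l, i)))) - (rt (cl (a (l, j))) - rt (cl (b (l, j))))); last by ring.
      apply: le_trans (ler_normB _ _) _.
      have h s : `|rt (cl (a s)) - rt (cl (b s))| <= ep / p%:R.
        apply: le_trans (rt_lip _ _ (cl1 _) (cl1 _)) _.
        by rewrite ler_pM2r ?invr_gt0 //; apply: le_trans (ab s); exact: cl_lip.
      by have := h (l, i); have := h (l, j); lra.
    apply: (@le_trans _ _ (p%:R * M ^+ n.+1 * (2 * ep / p%:R))).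
      by rewrite ler_wpM2l // mulr_ge0 ?exprn_ge0 ?ler0n.
    rewrite [X in X <= _](_ : _ = 2 * ep * M ^+ n.+1); last by field; rewrite gt_eqF.
    by rewrite ler_wpM2l ?mulr_ge0 // ler_iXnr //; lra.
  have c0 : 0 <= 2 * ep * M by exact: mulr_ge0 (mulr_ge0 _ ep0) M0.
  apply: le_trans (card_le _ _ c0) _.
  by have := ler_wpM2l ep0 kM; lra.
have sum_small i j : 0 <= \sum_(l | (l != i) && (l != j)) X a l i j ^+ p <= 1 / 4.
  rewrite sumr_ge0 /=; last by move=> l _; apply: exprn_ge0; case/andP: (XM a l i j).
  apply: (@le_trans _ _ (\sum_(l | (l != i) && (l != j)) M)); first exact: ler_sum.
  by apply: le_trans (card_le _ _ M0) _; lra.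
have a1B i j : i != j -> 1 <= a (i, j) <= B.
  move=> ij; rewrite -aT /T /=.
  by have := sum_small i j; have := e_ge4 i j ij; have := e_leB i j; lra.
have aC i j : a (i, j) = a (j, i).
  rewrite -[LHS]aT -[RHS]aT /T /= /e dC; congr ((_ - _) / 2).
  by apply: eq_big => [l|l _]; [rewrite andbC|rewrite /X distrC].
pose f l i := if i == l then 0 else rt (a (l, i)).
exists p, w, f; split=> // x y.
have [->|xy] := eqVneq x y.
  rewrite (dE y y).2 // big1 ?mulr0 // => l _.
  by rewrite subrr normr0 expr0n.
have -> : d x y = w * e x y by rewrite /e mulrC divfK // gt_eqF.
congr (_ * _); rewrite (bigD1 x) //= (bigD1 y) /=; last by rewrite eq_sym.
have yx : (y == x) = false by apply/eqP => yx; rewrite yx eqxx in xy.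
rewrite /f !eqxx yx (negbTE xy) sub0r subr0 normrN.
rewrite !ger0_norm ?powR_ge0 // !rtK; first last.
- by case/andP: (a1B _ _ xy).
- by have yx' : y != x; [rewrite yx|case/andP: (a1B _ _ yx')].
have E := aT (x, y); rewrite /T /= in E.
have -> : \sum_(i | (i != x) && (i != y))
    `|(if x == i then 0 else rt (a (i, x))) - (if y == i then 0 else rt (a (i, y)))| ^+ p
  = \sum_(l | (l != x) && (l != y)) X a l x y ^+ p.
  apply: eq_bigr => l /andP[lx ly].
  by rewrite /X !cl_id ?a1B // ![_ == l]eq_sym (negbTE lx) (negbTE ly).
rewrite (aC y x) -E; lra.
Qed.

(** * Interpolation by a perceptron *)

(* The direction is [(1, s, s^2, ...)] with [s] avoiding the roots of the
   polynomials whose coefficients are the coordinates of the differences. *)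
Lemma separating_direction (R : realType) (N k : nat) (x : 'I_k -> 'cV[R]_N) :
  injective x ->
  exists c : 'rV[R]_N, forall u v, u != v -> (c *m x u) 0 0 != (c *m x v) 0 0.
Proof.
move=> x_inj.
pose P u v : {poly R} := \poly_(i < N) (if insub i is Some j then x u j 0 - x v j 0 else 0).
have PE u v (j : 'I_N) : (P u v)`_j = x u j 0 - x v j 0.
  by rewrite coef_poly ltn_ord insubT //= => H; congr (x u _ 0 - x v _ 0); apply: val_inj.
have P0 u v : u != v -> P u v != 0.
  apply: contra_neq => P0; apply: x_inj; apply/matrixP => i j; rewrite (ord1 j).
  by apply/eqP; rewrite -subr_eq0 -PE P0 coef0.
pose Q := \prod_u \prod_(v | v != u) P u v.
have Q0 : Q != 0.
  by apply/prodf_neq0 => u _; apply/prodf_neq0 => v vu; apply: P0; rewrite eq_sym.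
have [n Qn] : exists n : nat, ~~ root Q n%:R.
  pose s := [seq i%:R : R | i <- iota 0 (size Q)].
  have us : uniq s by rewrite map_inj_uniq ?iota_uniq //; exact: mulrIn (oner_neq0 R).
  have [/allPn[_ /mapP[i _ ->] H]|] := boolP (~~ all (root Q) s); first by exists i.
  rewrite negbK => allQ; have := max_poly_roots Q0 allQ us.
  by rewrite size_map size_iota ltnn.
exists (\row_j n%:R ^+ j) => u v uv; apply: contraNneq Qn => e.
have : root (P u v) n%:R.
  rewrite /root horner_poly; apply/eqP.
  transitivity (\sum_(i < N) ((\row_j (n%:R : R) ^+ j) 0 i * x u i 0 - (\row_j (n%:R : R) ^+ j) 0 i * x v i 0)).
    apply: eq_bigr => i _; rewrite -mulrBr mulrC mxE; congr (_ * _).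
    rewrite insubT //= => H; by congr (x u _ 0 - x v _ 0); apply: val_inj.
  by rewrite sumrB; move: e; rewrite !mxE => ->; rewrite subrr.
rewrite /Q (bigD1 u) //= (bigD1 v) /=; last by rewrite eq_sym.
by rewrite !rootM => ->.
Qed.

Lemma nnz_le (R : realType) (m n : nat) (A : 'M[R]_(m, n)) : (nnz A <= m * n)%N.
Proof.
rewrite /nnz; apply: (@leq_trans (\sum_(i < m) n)%N).
  apply: leq_sum => i _; apply: (@leq_trans (\sum_(j < n) 1)%N).
    by apply: leq_sum => j _; case: (_ == _).
  by rewrite sum1_card card_ord.
by rewrite sum_nat_const card_ord.
Qed.

Lemma nnz0 (R : realType) (m n : nat) : nnz (0 : 'M[R]_(m, n)) = 0%N.
Proof.
by rewrite /nnz big1 // => i _; rewrite big1 // => j _; rewrite mxE eqxx.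
Qed.

(** For [e] at most the least gap between abscissas, the entry [(j, u)] vanishes when [t u < t j]
    and equals [e] on the diagonal: sorting by [t] makes the matrix triangular. *)
Lemma relu_matrix_unit (R : realType) (k : nat) (t : 'I_k -> R) :
  injective t -> exists e : R,
  \matrix_(j, u) relu (t u - t j + e) \in unitmx.
Proof.
move=> t_inj.
pose e := \big[Num.min/1]_(u : 'I_k) \big[Num.min/1]_(v | v != u) `|t u - t v|.
have e0 : 0 < e.
  apply: lt_bigmin => // u _; apply: lt_bigmin => // v vu.
  by rewrite normr_gt0 subr_eq0 (inj_eq t_inj) eq_sym.
have e_le u v : v != u -> e <= `|t u - t v|.
  move=> vu; apply: le_trans (bigmin_le_cond 1 (P := fun v => v != u) (fun v => `|t u - t v|) vu).
  exact: (bigmin_le 1 u (fun u => \big[Num.min/1]_(v | v != u) `|t u - t v|)).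
exists e; set G := (X in X \in _).
rewrite -unitmx_tr -row_free_unit -kermx_eq0.
apply/rowV0P => c /sub_kermxP cG; apply/eqP/negPn/negP => /rV0Pn[u0 cu0].
(* the coefficient at the largest abscissa cannot be cancelled *)
case: (arg_maxP t (P := fun u => c 0 u != 0) cu0) => u cu umax.
case/negP: cu; have := congr1 (fun A : 'rV_k => A 0 u) cG; rewrite !mxE (bigD1 u) //= big1.
  rewrite !mxE addr0 subrr add0r /relu max_l ?(ltW e0) // => /eqP.
  by rewrite mulf_eq0 (gt_eqF e0) orbF.
move=> v vu; rewrite !mxE; have [->|cv] := eqVneq (c 0 v) 0; first by rewrite mul0r.
have tvu : t v <= t u by exact: umax.
have := e_le u v vu; rewrite ger0_norm ?subr_ge0 // => h.
by rewrite /relu max_r ?mulr0 //; lra.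
Qed.

(** One hidden layer of [k] units sends [x u] to column [u] of the invertible matrix [G]; the output
    layer [Y *m invmx G] then prescribes the values. *)
Lemma mlp_interpolation (R : realType) (N k M : nat) (x : 'I_k -> 'cV[R]_N)
    (y : 'I_k -> 'cV[R]_M) :
  injective x ->
  exists E : mlp R N M, (forall u, mlp_eval E (x u) = y u) /\
    (mlp_count E <= k * N + k + M * k)%N.
Proof.
move=> x_inj; have [c cP] := separating_direction x_inj.
pose t u := (c *m x u) 0 0.
have t_inj : injective t by move=> u v tuv; apply/eqP/negPn/negP => /cP /eqP.
have [e] := relu_matrix_unit t_inj; set G := (X in X \in _) => Gunit.
pose Y : 'M[R]_(M, k) := \matrix_(i, u) y u i 0.
exists (MLPhid (\matrix_(j < k) c) (\col_j (e - t j)) (MLPout (Y *m invmx G) 0)); split.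
  move=> u /=; rewrite addr0.
  have -> : map_mx (@relu R) ((\matrix_(j < k) c) *m x u + \col_j (e - t j)) = col u G.
    apply/matrixP => j l; rewrite (ord1 l) !mxE; congr relu.
    have -> : \sum_(i < N) (\matrix_(j0 < k) c) j i * x u i 0 = t u.
      by rewrite /t mxE; apply: eq_bigr => i _; rewrite mxE.
    by ring.
  rewrite -mulmxA [invmx G *m _](_ : _ = col u 1%:M); last first.
    by rewrite !colE mulmxA mulVmx // mul1mx.
  by apply/matrixP => i l; rewrite (ord1 l) colE mul1mx -colE !mxE.
rewrite /= nnz0 addn0 !leq_add ?nnz_le //.
by apply: leq_trans (nnz_le _) _; rewrite muln1.
Qed.

(** * Neural representations *)

Section Representations.
Variable R : realType.

Lemma sigma_ge0 (s x : R) : 0 <= x -> sigma s s x = x `^ s.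
Proof. by move=> x0; rewrite /sigma /sgn x0 ger0_norm // if_same mul1r. Qed.

Lemma sigma1_id (x : R) : sigma 1 1 x = x.
Proof.
rewrite /sigma if_same powRr1 // /sgn; case: leP => x0; first by rewrite mul1r ger0_norm.
by rewrite ltr0_norm // mulN1r opprK.
Qed.

Lemma nnz_scalar1 (n : nat) : (nnz (1%:M : 'M[R]_n) <= n)%N.
Proof.
rewrite /nnz; apply: (@leq_trans (\sum_(i < n) 1)%N); last by rewrite sum1_card card_ord.
apply: leq_sum => i _; rewrite (bigD1 i) //= big1 => [|j ji].
  by rewrite addn0; case: (_ == _).
by rewrite mxE (eq_sym i j) (negbTE ji) eqxx.
Qed.

(** A single layer with exponents 1 and then [q]: [D] weights and four exponents. *)
Lemma power_nmetric (D T : nat) (w q : R) : 0 < w -> 0 < q ->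
  exists Dm : nmetric R D,
    [/\ nmetric_valid Dm, (nmetric_count Dm <= D + 4)%N &
        forall x y : 'cV[R]_(D + T),
          nmetric_eval Dm x y = w * \sum_i `|x (lshift T i) 0 - y (lshift T i) 0| `^ q].
Proof.
move=> w0 q0.
pose ex j : R := if j is 0%N then 1 else q.
exists (@NMetric R D 1 ex ex (fun=> 1%:M) (const_mx w)); split.
- split=> //= [[|j] _|j j1 j2|i]; rewrite ?ltr01 ?mxE //.
  by move: j1 j2; case: j.
- rewrite /nmetric_count /= big_geq // add0n leq_add2r.
  by apply: leq_trans (nnz_le _) _; rewrite mul1n.
move=> x y; rewrite /nmetric_eval /= mxE mulr_sumr; apply: eq_bigr => i _.
by rewrite !mxE /ex !sigma1_id sigma_ge0.
Qed.

Lemma identity_norder (T : nat) : exists To : norder R T,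
  [/\ norder_valid To, (norder_count To <= T + 1)%N &
      forall (a : R) (D : nat) (x : 'cV[R]_(D + T)) t,
        0 <= x (rshift D t) 0 -> norder_eval a To x t 0 = x (rshift D t) 0].
Proof.
exists (@NOrder R T 1 (fun=> 1) (fun=> 1%:M) (fun=> 0)); split.
- split=> //= j j1 j2; exists 1; split=> //; exists 0.
  by rewrite [map_mx _ _](_ : _ = 0) ?addr0 //; apply/matrixP => i l; rewrite !mxE normr0.
- by rewrite /norder_count /= big_nat1 nnz0 addn0 leq_add2r nnz_scalar1.
by move=> a D x t xt; rewrite /norder_eval /= mul1mx addr0 !mxE sigma1_id /leaky_relu xt.
Qed.

Lemma lg_ge1 (x : R) : 1 <= lg x.
Proof. by rewrite /lg lerDl ln_ge0 // le_max lexx. Qed.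

Lemma enc_bound_ge (k D N : nat) (dm sp : R) : (0 < k)%N -> (0 < D)%N ->
  (k * k * D * N)%:R <= enc_bound k D N dm sp.
Proof.
move=> k0 D0; rewrite /enc_bound !natrM.
have k1 : 1 <= k%:R :> R by rewrite (ler_nat _ 1).
have D1 : 1 <= D%:R :> R by rewrite (ler_nat _ 1).
have N0 : 0 <= N%:R :> R by exact: ler0n.
have kk : k%:R * k%:R <= k%:R `^ (5%:R / 2%:R) :> R.
  rewrite -expr2 -powR_mulrn ?ler0n // ler_powR //; lra.
have DD : D%:R <= D%:R ^+ 4 :> R by rewrite ler_eXnr.
have base : k%:R * k%:R * D%:R * N%:R <= k%:R `^ (5%:R / 2%:R) * D%:R ^+ 4 * N%:R :> R.
  by rewrite ler_wpM2r // ler_pM // mulr_ge0.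
apply: le_trans base _.
have b0 : 0 <= k%:R `^ (5%:R / 2%:R) * D%:R ^+ 4 * N%:R :> R.
  by rewrite !mulr_ge0 ?powR_ge0 ?exprn_ge0.
rewrite -[X in _ <= X]mulrA ler_peMr // -[1]mulr1 ler_pM ?lg_ge1 //.
Qed.

Lemma width_le (k W : nat) (le : 'I_k -> 'I_k -> Prop) : width le W -> (W <= k)%N.
Proof. by case=> [[S [_ <-]] _]; rewrite -[X in (_ <= X)%N]card_ord max_card. Qed.

(** Common to both metric cases: the perceptron outputs the metric coordinates followed by the chain
    counts, which are nonnegative and so pass through LeakyReLU unchanged. *)
Lemma neural_realization (a : R) (W N k D : nat) (x : 'I_k -> 'cV[R]_N)
    (le : 'I_k -> 'I_k -> Prop) (f : 'I_D -> 'I_k -> R) (w q dm sp : R) :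
  (0 < N)%N -> (0 < k)%N -> (0 < D)%N -> 0 < w -> 0 < q ->
  injective x -> is_partial_order le -> width le W ->
  exists (E : mlp R N (D + W)) (Dm : nmetric R D) (To : norder R W),
    [/\ nmetric_valid Dm /\ norder_valid To,
        forall u v, le u v <->
          order_leT (norder_eval a To (mlp_eval E (x u)))
                    (norder_eval a To (mlp_eval E (x v))),
        forall u v, nmetric_eval Dm (mlp_eval E (x u)) (mlp_eval E (x v)) =
                    w * \sum_i `|f i u - f i v| `^ q &
        [/\ (nmetric_count Dm + norder_count To <= D + W + 8)%N,
            (mlp_count E)%:R <= 4 * enc_bound k D N dm sp &
            (nmetric_count Dm + norder_count To + mlp_count E)%:R
              <= 6 * ((D + W)%:R + enc_bound k D N dm sp)]].
Proof.
move=> N0 k0 D0 w0 q0 x_inj le_po leW.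
have [g gP] := width_order_embedding le_po leW.
pose y u : 'cV[R]_(D + W) := col_mx (\col_i f i u) (\col_t (g t u)%:R).
have [E [Ey Ecount]] := mlp_interpolation y x_inj.
have [Dm [Dm_valid Dm_count Dm_eval]] := @power_nmetric D W w q w0 q0.
have [To [To_valid To_count To_eval]] := identity_norder W.
exists E, Dm, To.
have small : (mlp_count E)%:R <= 4 * enc_bound k D N dm sp.
  apply: le_trans (_ : (4 * (k * k * D * N))%:R <= _); last first.
    by rewrite natrM ler_wpM2l // enc_bound_ge.
  rewrite ler_nat; apply: leq_trans Ecount _.
  have Wk := width_le leW.
  have h1 : (k * N <= k * k * D * N)%N.
    by rewrite leq_mul2r -mulnA leq_pmulr ?muln_gt0 ?k0 ?D0 ?orbT.
  have h2 : (k <= k * N)%N by rewrite leq_pmulr.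
  have h3 : (D * k <= k * k * D * N)%N.
    by rewrite mulnC -[X in (X <= _)%N]muln1 leq_mul // leq_mul // leq_pmulr.
  have h4 : (W * k <= k * k * D * N)%N.
    rewrite -[(_ * _ * D * N)%N]mulnA; apply: (@leq_trans (k * k)%N); first by rewrite leq_mul2r Wk orbT.
    by rewrite leq_pmulr // muln_gt0 D0.
  by rewrite mulnDl; lia.
split=> //.
- move=> u v; rewrite gP !Ey /order_leT; split=> H t; have := H t.
    by rewrite !To_eval ?col_mxEd ?mxE ?ler0n // ler_nat.
  by rewrite !To_eval ?col_mxEd ?mxE ?ler0n // ler_nat.
- move=> u v; rewrite Dm_eval !Ey; congr (_ * _); apply: eq_bigr => i _.
  by rewrite !col_mxEu !mxE.
- split=> //; first by lia.
  rewrite natrD mulrDr lerD //.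
    by rewrite -natrM ler_nat; lia.
  apply: le_trans small _; apply: ler_wpM2r; last by lra.
  exact: le_trans (ler0n _ _) (enc_bound_ge _ _ _ k0 D0).
Qed.

Lemma log_scale (K : nat) : (0 < K)%N -> exists kap : nat,
  [/\ (0 < kap)%N, (K <= 2 ^ kap)%N & kap%:R <= 2 * lg K%:R :> R].
Proof.
move=> K0; exists (trunc_log 2 K).+1; split=> //; first by rewrite ltnW // trunc_log_ltn.
have K1 : 1 <= K%:R :> R by rewrite (ler_nat _ 1).
rewrite /lg max_r //.
(* From [ln (1 + x) <= x] at [x = - 1 / 2]. *)
have ln2 : 1 / 2 <= ln 2 :> R.
  have := @le_ln1Dx R (- (1 / 2)); rewrite (_ : 1 + - (1 / 2) = 2^-1); last by field.
  by rewrite lnV ?posrE // => /(_ ltac:(lra)); lra.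
have : ln ((2 : R) ^+ trunc_log 2 K) <= ln K%:R.
  by rewrite ler_ln ?posrE ?exprn_gt0 ?ltr0n // -natrX ler_nat trunc_logP.
rewrite lnXn // -[_ *+ trunc_log 2 K]mulr_natl -natr1.
have : (trunc_log 2 K)%:R * (1 / 2) <= (trunc_log 2 K)%:R * ln 2 :> R by rewrite ler_wpM2l.
move=> h1 h2; have := le_trans h1 h2; lra.
Qed.

End Representations.

(** * Assembly of the approximate and the exact case *)

Theorem mainTheorem1 (R : realType) :
  exists C : R, 0 < C /\
  forall (a : R), 0 < a -> a < 1 ->
  forall (W N k K : nat) (x : 'I_k -> 'cV[R]_N)
         (le : 'I_k -> 'I_k -> Prop) (d : 'I_k -> 'I_k -> R),
  (0 < W)%N -> (0 < N)%N -> (0 < k)%N ->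
  injective x -> is_metric d -> is_partial_order le ->
  doubling_constant d K -> width le W ->
  (exists (D : nat) (E : mlp R N (D + W)) (Dm : nmetric R D) (To : norder R W),
     [/\ (0 < D)%N /\ D%:R <= C * lg K%:R,
         nmetric_valid Dm /\ norder_valid To,
         forall u v, le u v <->
           order_leT (norder_eval a To (mlp_eval E (x u)))
                     (norder_eval a To (mlp_eval E (x v))),
         forall u v, d u v <= nmetric_eval Dm (mlp_eval E (x u)) (mlp_eval E (x v))
                     <= C * lg K%:R ^+ 5 * d u v &
         [/\ (nmetric_count Dm + norder_count To <= D + W + 8)%N,
             (mlp_count E)%:R <= C * enc_bound k D N (diam d) (sep d) &
             (nmetric_count Dm + norder_count To + mlp_count E)%:R
               <= C * ((D + W)%:R + enc_bound k D N (diam d) (sep d))]])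
  /\
  (exists (D : nat) (E : mlp R N (D + W)) (Dm : nmetric R D) (To : norder R W),
     [/\ (0 < D)%N /\ (D <= k)%N,
         nmetric_valid Dm /\ norder_valid To,
         forall u v, le u v <->
           order_leT (norder_eval a To (mlp_eval E (x u)))
                     (norder_eval a To (mlp_eval E (x v))),
         forall u v, d u v = nmetric_eval Dm (mlp_eval E (x u)) (mlp_eval E (x v)) &
         [/\ (nmetric_count Dm + norder_count To <= D + W + 8)%N,
             (mlp_count E)%:R <= C * enc_bound k D N (diam d) (sep d) &
             (nmetric_count Dm + norder_count To + mlp_count E)%:R
               <= C * ((D + W)%:R + enc_bound k D N (diam d) (sep d))]]).
Proof.
(* The factor [8 * 2048 ^+ 4] comes from [assouad], [512 = 32 * 16] from summing the upper bounds
   over the coordinates, and [2 ^+ 5] from [kap <= 2 * lg K]. *)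
pose C : R := 8 * 2048 ^+ 4 * 512 * 2 ^+ 5.
have C64 : 64 <= C.
  have h1 : 1 <= 2048 ^+ 4 :> R by apply: exprn_ege1; rewrite (ler_nat _ 1).
  have h2 : 1 <= 2 ^+ 5 :> R by apply: exprn_ege1; rewrite (ler_nat _ 1).
  rewrite /C; move: (2048 ^+ 4) (2 ^+ 5) h1 h2 => t s t1 s1.
  by have : 1 <= t * s; [rewrite -[1]mulr1 ler_pM|lra].
(* The constant is made opaque so that arithmetic does not expand it. *)
move: C64; move CE : C => C' C64.
exists C'; split; first by lra.
move=> a a0 a1 W N k K x le d W0 N0 k0 x_inj d_metric le_po [K0 d_doubling _] leW.
have [d0 dE _ _] := d_metric.
have weaken D (c1 c2 : nat) : (0 < D)%N ->
    c1%:R <= 4 * enc_bound k D N (diam d) (sep d) ->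
    c2%:R <= 6 * ((D + W)%:R + enc_bound k D N (diam d) (sep d)) ->
    c1%:R <= C' * enc_bound k D N (diam d) (sep d) /\
    c2%:R <= C' * ((D + W)%:R + enc_bound k D N (diam d) (sep d)).
  move=> D0 h1 h2.
  have e0 := le_trans (ler0n _ _) (enc_bound_ge N (diam d) (sep d) k0 D0).
  split; [apply: le_trans h1 _ | apply: le_trans h2 _]; apply: ler_wpM2r => //; try lra.
  by rewrite addr_ge0 ?ler0n.
split.
  have [kap [kap0 Kkap kap_lg]] := log_scale R K0.
  have [f [c [c0 c_le fup flo]]] := assouad kap0 d_metric (doubling_ok_le Kkap d_doubling).
  have D0 : (0 < 32 * kap)%N by rewrite muln_gt0.
  have q0 : 0 < 4 / 3 :> R by lra.
  have [E [Dm [To [valid order metric [cnt1 cnt2 cnt3]]]]] :=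
    neural_realization a f (diam d) (sep d) N0 k0 D0 c0 q0 x_inj le_po leW.
  exists (32 * kap)%N, E, Dm, To; split=> //; last first.
  - by have [] := weaken _ _ _ D0 cnt2 cnt3.
  - move=> u v; rewrite metric; apply/andP; split.
      have [->|uv] := eqVneq u v.
        rewrite (dE v v).2 // mulr_ge0 ?(ltW c0) // sumr_ge0 // => i _; exact: powR_ge0.
      have [i di] := flo u v uv; apply: le_trans di _; rewrite ler_pM2l //.
      by rewrite (bigD1 i) //= lerDl sumr_ge0 // => j _; exact: powR_ge0.
    apply: (@le_trans _ _ (c * ((32 * kap)%:R * (16 * d u v)))).
      rewrite ler_pM2l //; apply: (@le_trans _ _ (\sum_(i < 32 * kap) 16 * d u v)).
        exact: ler_sum.
      by rewrite sumr_const card_ord -[_ *+ (32 * kap)]mulr_natl.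
    rewrite natrM.
    have -> : c * (32%:R * kap%:R * (16 * d u v)) = c * (kap%:R * 512) * d u v by ring.
    rewrite ler_wpM2r //; apply: (@le_trans _ _ (8 * (2048 * kap%:R) ^+ 4 * (kap%:R * 512))).
      by rewrite ler_wpM2r // mulr_ge0.
    have -> : 8 * (2048 * kap%:R) ^+ 4 * (kap%:R * 512) = 8 * 2048 ^+ 4 * 512 * kap%:R ^+ 5 :> R.
      by rewrite exprMn; move: (2048 ^+ 4) => t; ring.
    have -> : C' * lg K%:R ^+ 5 = 8 * 2048 ^+ 4 * 512 * (2 * lg K%:R) ^+ 5.
      by rewrite -CE /C [(2 * lg _) ^+ 5]exprMn -[LHS]mulrA.
    rewrite ler_wpM2l ?mulr_ge0 ?exprn_ge0 // lerXn2r ?nnegrE ?ler0n //.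
    by have := lg_ge1 (K%:R : R); lra.
  - split=> //; rewrite natrM; apply: (@le_trans _ _ (64 * lg K%:R)); first by lra.
    by rewrite ler_wpM2r //; have := lg_ge1 (K%:R : R); lra.
have [p [w [f [p0 w0 fE]]]] := exact_power_embedding d_metric.
have q0 : 0 < p%:R :> R by rewrite ltr0n.
have [E [Dm [To [valid order metric [cnt1 cnt2 cnt3]]]]] :=
  neural_realization a f (diam d) (sep d) N0 k0 k0 w0 q0 x_inj le_po leW.
exists k, E, Dm, To; split=> //; last by have [] := weaken _ _ _ k0 cnt2 cnt3.
move=> u v; rewrite metric fE; congr (_ * _); apply: eq_bigr => i _.
by rewrite powR_mulrn.
Qed.
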